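(* Let $a=1$, $b=-1$. The map $\Psi:D_1\to\tilde D$, $\Psi(J,E)=(\tilde M(J,E),\tilde P(J,E))$, is a diffeomorphism, where $$\tilde D=\Big\{(\tilde M,\tilde P)\in\mathbb{R}^2:\ \tilde M>0,\ 0<\tilde P<\frac{\tilde M}{\pi}\sqrt{3\tilde M^2+\pi^2-\sqrt{9\tilde M^4+4\tilde M^2\pi^2}}\Big\}.$$
   Context: With $a=1$, $b=-1$ (defocusing cubic NLS $i\psi_t+\psi_{xx}-|\psi|^2\psi=0$, standing waves $e^{-it}u(x)$ with $u_{xx}+u-|u|^2u=0$), let $J=\operatorname{Im}(u\bar u_x)$, $E=\frac12|u_x|^2+\frac12|u|^2-\frac14|u|^4$, and $V_J(r)=\frac{J^2}{2r^2}+\frac{r^2}{2}-\frac{r^4}{4}$. For $0<J<\sqrt{4/27}$ write $J=q(1-q^2)=Q(1-Q^2)$ with $0<q<1/\sqrt3<Q<1$, and set $E_-(J)=\frac14(1-Q^2)(3Q^2+1)$, $E_+(J)=\frac14(1-q^2)(3q^2+1)$. Let $D_1=\{(J,E):0<J<\sqrt{4/27},\ E_-(J)<E<E_+(J)\}$. For $(J,E)\in D_1$, let $r_1<r_2<r_3$ be the positive roots of $E-V_J(r)$ and define $T(J,E)=2\int_{r_1}^{r_2}\frac{dr}{\sqrt{2(E-V_J(r))}}$, $\tilde M(J,E)=\int_{r_1}^{r_2}\frac{r^2\,dr}{\sqrt{2(E-V_J(r))}}$ and $\tilde P(J,E)=\frac12 J\,T(J,E)$ (the period, mass $\frac12\int_0^T|u|^2$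 and momentum $\frac12\operatorname{Im}\int_0^T u\bar u_x$ of the corresponding solution). *)

(* Defs.v *)
From Stdlib Require Import Reals ClassicalEpsilon.
From Coquelicot Require Import Coquelicot.
Open Scope R_scope.

(* Effective potential with a = 1, b = -1. *)
Definition VJ (J r : R) : R := J ^ 2 / (2 * r ^ 2) + r ^ 2 / 2 - r ^ 4 / 4.

Definition roots3 (J E r1 r2 r3 : R) : Prop :=
  0 < r1 /\ r1 < r2 /\ r2 < r3 /\
  forall r, 0 < r -> (E - VJ J r = 0 <-> (r = r1 \/ r = r2 \/ r = r3)).

Definition root1 (J E : R) : R :=
  epsilon (inhabits 0) (fun r => exists r2 r3, roots3 J E r r2 r3).
Definition root2 (J E : R) : R :=
  epsilon (inhabits 0) (fun r => exists r1 r3, roots3 J E r1 r r3).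

Definition D1 (J E : R) : Prop :=
  0 < J /\ J < sqrt (4 / 27) /\
  exists q Q, 0 < q /\ q < 1 / sqrt 3 /\ 1 / sqrt 3 < Q /\ Q < 1 /\
    J = q * (1 - q ^ 2) /\ J = Q * (1 - Q ^ 2) /\
    / 4 * (1 - Q ^ 2) * (3 * Q ^ 2 + 1) < E /\
    E < / 4 * (1 - q ^ 2) * (3 * q ^ 2 + 1).

Definition Tper (J E : R) : R :=
  2 * RInt_gen (fun r => 1 / sqrt (2 * (E - VJ J r)))
        (at_right (root1 J E)) (at_left (root2 J E)).
Definition Mtilde (J E : R) : R :=
  RInt_gen (fun r => r ^ 2 / sqrt (2 * (E - VJ J r)))
        (at_right (root1 J E)) (at_left (root2 J E)).
Definition Ptilde (J E : R) : R := / 2 * J * Tper J E.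

Definition Psi (J E : R) : R * R := (Mtilde J E, Ptilde J E).

Definition Dt (M P : R) : Prop :=
  0 < M /\ 0 < P /\
  P < M / PI * sqrt (3 * M ^ 2 + PI ^ 2 - sqrt (9 * M ^ 4 + 4 * M ^ 2 * PI ^ 2)).

(* C^k regularity of a real function of two variables on a set U
   (intended for open U): continuous partial derivatives up to order k. *)
Fixpoint Ck (k : nat) (U : R -> R -> Prop) (f : R -> R -> R) : Prop :=
  match k with
  | O => forall x y, U x y -> continuity_2d_pt f x y
  | S k => exists fx fy : R -> R -> R,
      (forall x y, U x y -> differentiable_pt_lim f x y (fx x y) (fy x y)) /\
      Ck k U fx /\ Ck k U fy
  end.

Definition smooth_on (U : R -> R -> Prop) (f : R -> R -> R) : Prop :=
  forall k, Ck k U f.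

Definition smooth_map_on (U : R -> R -> Prop) (F : R -> R -> R * R) : Prop :=
  smooth_on U (fun x y => fst (F x y)) /\ smooth_on U (fun x y => snd (F x y)).

Definition diffeomorphism (U V : R -> R -> Prop) (F : R -> R -> R * R) : Prop :=
  (forall x y, U x y -> V (fst (F x y)) (snd (F x y))) /\
  smooth_map_on U F /\
  exists G : R -> R -> R * R,
    (forall u v, V u v -> U (fst (G u v)) (snd (G u v))) /\
    (forall x y, U x y -> G (fst (F x y)) (snd (F x y)) = (x, y)) /\
    (forall u v, V u v -> F (fst (G u v)) (snd (G u v)) = (u, v)) /\
    smooth_map_on V G.

(* Main.v *)
Require Import Defs.
From Stdlib Require Import Reals Lra Psatz ClassicalEpsilon.
From Coquelicot Require Import Coquelicot.
Open Scope R_scope.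

(** With y = r^2, the three turning points y1 < y2 < y3 satisfy y1 + y2 + y3 = 2,
    so the orbits are parametrised by m = (y2 - y1) / (y3 - y1) in (0, 1) and
    b = y1 / (y3 - y1) > 0.  The map (m, b) -> (J, E) is a diffeomorphism onto D1,
    and in these coordinates mass and momentum are explicit in terms of the
    complete elliptic integrals K(m), E(m) of parameter m = k^2.
    For fixed m the mass increases with b, hence each level curve of the mass is a
    graph b = b(m) over an interval [0, m1].  The sign of the Jacobian, which only
    needs 1 - m <= E/K <= 1 - m/2, shows that the momentum decreases strictly along
    the curve; it is 0 at m = m1 (where b = 0, i.e. J = 0), and its value at m = 0
    (where y1 = y2, the circular orbit) is the upper bound in the definition of
    the target domain.  Hence (m, b) -> (M, P) is injective, regular and onto. *)

(** * Calculus of C^k functions of two variables *)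

(** The orbit integrals are singular at both turning points, and these move with (J, E). So [Psi] is
    never differentiated directly: on [D1] it is [mass_mom] composed with the inverse of [wave_JE],
    and both of these maps are explicit. The relation y1 + y2 + y3 = 2 fixes the scale, 3 b + 1 + m
    = 2 / (y3 - y1), which leaves exactly the two ratios m and b. A nonzero Jacobian gives
    invertibility only locally. Global injectivity is proved on its own, and it also drives the
    openness argument: the image of the centre of a square keeps a positive distance from the image
    of its edges. The level curves of the mass are tractable because squaring massF = M gives an
    equation quadratic in b. Their parameter interval ends at some m1 < 1 because K - E diverges as
    m tends to 1. The bound E/K <= 1 - m/2 is false between the integrands; it becomes pointwise
    after adding an exact derivative with zero integral. *)

Definition open_2d (U : R -> R -> Prop) : Prop :=
  forall x y, U x y -> locally_2d U x y.

Lemma differentiable_pt_lim_continuity_2d f x y a b :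
  differentiable_pt_lim f x y a b -> continuity_2d_pt f x y.
Proof.
  intros H; apply differentiable_continuity_pt; now exists a, b.
Qed.

Lemma differentiable_pt_lim_uniq f x y a b a' b' :
  differentiable_pt_lim f x y a b -> differentiable_pt_lim f x y a' b' ->
  a = a' /\ b = b'.
Proof.
  intros H H'.
  destruct (differentiable_pt_lim_unique _ _ _ _ _ H) as [<- <-].
  destruct (differentiable_pt_lim_unique _ _ _ _ _ H') as [<- <-].
  now split.
Qed.

Lemma differentiable_pt_lim_eq f x y a b a' b' :
  differentiable_pt_lim f x y a b -> a = a' -> b = b' ->
  differentiable_pt_lim f x y a' b'.
Proof. now intros H <- <-. Qed.

(** Continuity and differentiability at a point see a whole neighbourhood, so agreement on U
    suffices only because U is open. The partial derivatives of f serve unchanged for g. *)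
Lemma Ck_ext k U f g :
  open_2d U -> (forall x y, U x y -> f x y = g x y) -> Ck k U f -> Ck k U g.
Proof.
  intros HU Hfg; destruct k as [|k]; simpl.
  - intros H x y Hxy.
    apply (continuity_2d_pt_ext_loc f); [|now apply H].
    destruct (HU x y Hxy) as [d Hd]; exists d; intros; apply Hfg; auto.
  - intros (fx & fy & H & Hx & Hy); exists fx, fy; split; [|now split].
    intros x y Hxy.
    apply (differentiable_pt_lim_ext f); [|now apply H].
    destruct (HU x y Hxy) as [d Hd]; exists d; intros; apply Hfg; auto.
Qed.

Lemma Ck_continuity_2d k U f :
  Ck k U f -> forall x y, U x y -> continuity_2d_pt f x y.
Proof.
  destruct k as [|k]; [now simpl|].
  intros (fx & fy & H & _) x y Hxy.
  apply (differentiable_pt_lim_continuity_2d _ _ _ _ _ (H x y Hxy)).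
Qed.

Lemma Ck_pred k U f : Ck (S k) U f -> Ck k U f.
Proof.
  revert f; induction k as [|k IH]; intros f H.
  - exact (Ck_continuity_2d _ _ _ H).
  - destruct H as (fx & fy & H & Hx & Hy); exists fx, fy; split; [exact H|].
    split; now apply IH.
Qed.

Lemma Ck_subset k (U V : R -> R -> Prop) f :
  (forall x y, U x y -> V x y) -> Ck k V f -> Ck k U f.
Proof.
  intros HUV; revert f; induction k as [|k IH]; intros f.
  - intros H x y Hxy; apply H; auto.
  - intros (fx & fy & H & Hx & Hy); exists fx, fy; split; [auto|]; split; auto.
Qed.

Lemma differentiable_pt_lim_const c x y :
  differentiable_pt_lim (fun _ _ => c) x y 0 0.
Proof.
  apply (differentiable_pt_lim_proj1_0 (fun _ => c)), derivable_pt_lim_const.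
Qed.

Lemma differentiable_pt_lim_fst x y :
  differentiable_pt_lim (fun u _ => u) x y 1 0.
Proof.
  apply (differentiable_pt_lim_proj1_0 (fun u => u)), derivable_pt_lim_id.
Qed.

Lemma differentiable_pt_lim_snd x y :
  differentiable_pt_lim (fun _ v => v) x y 0 1.
Proof.
  intros eps; exists (mkposreal 1 Rlt_0_1); intros u v _ _.
  replace (v - y - (0 * (u - x) + 1 * (v - y))) with 0 by ring.
  rewrite Rabs_R0; apply Rmult_le_pos; [apply Rlt_le, cond_pos|].
  apply Rle_trans with (2 := Rmax_l _ _), Rabs_pos.
Qed.

Lemma differentiable_pt_lim_add x y :
  differentiable_pt_lim Rplus x y 1 1.
Proof.
  intros eps; exists (mkposreal 1 Rlt_0_1); intros u v _ _.
  replace (u + v - (x + y) - (1 * (u - x) + 1 * (v - y))) with 0 by ring.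
  rewrite Rabs_R0; apply Rmult_le_pos; [apply Rlt_le, cond_pos|].
  apply Rle_trans with (2 := Rmax_l _ _), Rabs_pos.
Qed.

Lemma differentiable_pt_lim_mul x y :
  differentiable_pt_lim Rmult x y y x.
Proof.
  intros eps; exists eps; intros u v Hu Hv.
  replace (u * v - x * y - (y * (u - x) + x * (v - y)))
    with ((u - x) * (v - y)) by ring.
  rewrite Rabs_mult; apply Rmult_le_compat; try apply Rabs_pos.
  - now apply Rlt_le.
  - apply Rmax_r.
Qed.

Lemma differentiable_pt_lim_comp_1d g f x y a b l :
  derivable_pt_lim g (f x y) l -> differentiable_pt_lim f x y a b ->
  differentiable_pt_lim (fun u v => g (f u v)) x y (l * a) (l * b).
Proof.
  intros Hg Hf.
  eapply differentiable_pt_lim_eq.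
  - apply (differentiable_pt_lim_comp (fun u _ => g u) f (fun _ _ => 0)).
    + apply differentiable_pt_lim_proj1_0, Hg.
    + exact Hf.
    + apply differentiable_pt_lim_const.
  - ring.
  - ring.
Qed.

Lemma differentiable_pt_lim_plus f g x y a b c d :
  differentiable_pt_lim f x y a b -> differentiable_pt_lim g x y c d ->
  differentiable_pt_lim (fun u v => f u v + g u v) x y (a + c) (b + d).
Proof.
  intros Hf Hg; eapply differentiable_pt_lim_eq.
  - apply (differentiable_pt_lim_comp Rplus f g);
      [apply differentiable_pt_lim_add|exact Hf|exact Hg].
  - ring.
  - ring.
Qed.

Lemma differentiable_pt_lim_mult f g x y a b c d :
  differentiable_pt_lim f x y a b -> differentiable_pt_lim g x y c d ->
  differentiable_pt_lim (fun u v => f u v * g u v) x y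
    (g x y * a + f x y * c) (g x y * b + f x y * d).
Proof.
  intros Hf Hg.
  apply (differentiable_pt_lim_comp Rmult f g);
    [apply differentiable_pt_lim_mul|exact Hf|exact Hg].
Qed.

Lemma differentiable_pt_lim_inv f x y a b :
  f x y <> 0 -> differentiable_pt_lim f x y a b ->
  differentiable_pt_lim (fun u v => / f u v) x y
    (- / (f x y) ^ 2 * a) (- / (f x y) ^ 2 * b).
Proof.
  intros Hn Hf.
  apply (differentiable_pt_lim_comp_1d Rinv); [|exact Hf].
  apply is_derive_Reals; auto_derive; [exact Hn|field; exact Hn].
Qed.

Lemma differentiable_pt_lim_sqrt f x y a b :
  0 < f x y -> differentiable_pt_lim f x y a b ->
  differentiable_pt_lim (fun u v => sqrt (f u v)) x y
    (/ (2 * sqrt (f x y)) * a) (/ (2 * sqrt (f x y)) * b).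
Proof.
  intros Hn Hf.
  apply (differentiable_pt_lim_comp_1d sqrt); [|exact Hf].
  now apply derivable_pt_lim_sqrt.
Qed.

Lemma Ck_const k U c : Ck k U (fun _ _ => c).
Proof.
  revert c; induction k as [|k IH]; intros c.
  - intros x y _; apply continuity_2d_pt_const.
  - exists (fun _ _ => 0), (fun _ _ => 0); split; [|split; apply IH].
    intros; apply differentiable_pt_lim_const.
Qed.

Lemma Ck_fst k U : Ck k U (fun u _ => u).
Proof.
  destruct k as [|k].
  - intros x y _; apply continuity_2d_pt_id1.
  - exists (fun _ _ => 1), (fun _ _ => 0); split; [|split; apply Ck_const].
    intros; apply differentiable_pt_lim_fst.
Qed.

Lemma Ck_snd k U : Ck k U (fun _ v => v).
Proof.
  destruct k as [|k].
  - intros x y _; apply continuity_2d_pt_id2.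
  - exists (fun _ _ => 0), (fun _ _ => 1); split; [|split; apply Ck_const].
    intros; apply differentiable_pt_lim_snd.
Qed.

Lemma Ck_plus k U f g : Ck k U f -> Ck k U g -> Ck k U (fun x y => f x y + g x y).
Proof.
  revert f g; induction k as [|k IH]; intros f g.
  - intros Hf Hg x y Hxy; apply continuity_2d_pt_plus; auto.
  - intros (fx & fy & Hf & Hfx & Hfy) (gx & gy & Hg & Hgx & Hgy).
    exists (fun x y => fx x y + gx x y), (fun x y => fy x y + gy x y).
    split; [|split; now apply IH].
    intros; apply differentiable_pt_lim_plus; auto.
Qed.

Lemma Ck_mult k U f g : Ck k U f -> Ck k U g -> Ck k U (fun x y => f x y * g x y).
Proof.
  revert f g; induction k as [|k IH]; intros f g.
  - intros Hf Hg x y Hxy; apply continuity_2d_pt_mult; auto.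
  - intros Hf0 Hg0; pose proof (Ck_pred _ _ _ Hf0); pose proof (Ck_pred _ _ _ Hg0).
    destruct Hf0 as (fx & fy & Hf & Hfx & Hfy).
    destruct Hg0 as (gx & gy & Hg & Hgx & Hgy).
    exists (fun x y => g x y * fx x y + f x y * gx x y),
      (fun x y => g x y * fy x y + f x y * gy x y).
    split; [|split; apply Ck_plus; now apply IH].
    intros; apply differentiable_pt_lim_mult; auto.
Qed.

Lemma Ck_opp k U f : Ck k U f -> Ck k U (fun x y => - f x y).
Proof.
  revert f; induction k as [|k IH]; intros f.
  - intros Hf x y Hxy; apply continuity_2d_pt_opp; auto.
  - intros (fx & fy & Hf & Hfx & Hfy).
    exists (fun x y => - fx x y), (fun x y => - fy x y).
    split; [|split; now apply IH].
    intros x y Hxy; eapply differentiable_pt_lim_eq.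
    + apply (differentiable_pt_lim_comp_1d Ropp); [|now apply Hf].
      apply derivable_pt_lim_opp, derivable_pt_lim_id.
    + ring.
    + ring.
Qed.

Lemma Ck_minus k U f g : Ck k U f -> Ck k U g -> Ck k U (fun x y => f x y - g x y).
Proof. intros Hf Hg; apply Ck_plus; [|apply Ck_opp]; assumption. Qed.

Lemma continuity_2d_pt_comp f g h x y :
  continuity_2d_pt f (g x y) (h x y) ->
  continuity_2d_pt g x y -> continuity_2d_pt h x y ->
  continuity_2d_pt (fun u v => f (g u v) (h u v)) x y.
Proof.
  intros Hf Hg Hh eps.
  destruct (Hf eps) as [d Hd].
  destruct (Hg d) as [d1 Hd1]; destruct (Hh d) as [d2 Hd2].
  assert (Hd12 : 0 < Rmin d1 d2) by (apply Rmin_pos; apply cond_pos).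
  exists (mkposreal _ Hd12); simpl; intros u v Hu Hv.
  pose proof (Rmin_l d1 d2); pose proof (Rmin_r d1 d2).
  apply Hd; [apply Hd1|apply Hd2]; lra.
Qed.

(** The chain rule produces partials of f composed with (g, h), times partials of g and h. The
    induction hypothesis therefore needs g and h themselves at the lower order, which [Ck_pred]
    supplies. *)
Lemma Ck_comp k U V f g h :
  Ck k V f -> Ck k U g -> Ck k U h -> (forall x y, U x y -> V (g x y) (h x y)) ->
  Ck k U (fun x y => f (g x y) (h x y)).
Proof.
  intros Hf Hg Hh HUV; revert f g h HUV Hf Hg Hh.
  induction k as [|k IH]; intros f g h HUV.
  - intros Hf Hg Hh x y Hxy; apply continuity_2d_pt_comp; auto.
  - intros Hf0 Hg0 Hh0; pose proof (Ck_pred _ _ _ Hg0); pose proof (Ck_pred _ _ _ Hh0).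
    destruct Hf0 as (fx & fy & Hf & Hfx & Hfy).
    destruct Hg0 as (gx & gy & Hg & Hgx & Hgy).
    destruct Hh0 as (hx & hy & Hh & Hhx & Hhy).
    exists (fun x y => fx (g x y) (h x y) * gx x y + fy (g x y) (h x y) * hx x y),
      (fun x y => fx (g x y) (h x y) * gy x y + fy (g x y) (h x y) * hy x y).
    split; [|split; apply Ck_plus; apply Ck_mult; auto].
    intros x y Hxy; apply differentiable_pt_lim_comp; auto.
Qed.

(** A one-variable function is carried as a function of two variables that ignores the second, so
    that [Ck_comp] applies to it. Its derivative is a polynomial in / x, which closes the
    induction. *)
Lemma Ck_inv_fst k : Ck k (fun x _ => x <> 0) (fun x _ => / x).
Proof.
  induction k as [|k IH].
  - intros x y Hx; apply continuity_2d_pt_inv; [apply continuity_2d_pt_id1|exact Hx].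
  - exists (fun x _ => - (/ x * / x)), (fun _ _ => 0).
    split; [|split; [apply Ck_opp, Ck_mult; exact IH|apply Ck_const]].
    intros x y Hx; apply differentiable_pt_lim_proj1_0.
    apply is_derive_Reals; auto_derive; [exact Hx|field; exact Hx].
Qed.

Lemma Ck_inv k U f :
  Ck k U f -> (forall x y, U x y -> f x y <> 0) -> Ck k U (fun x y => / f x y).
Proof.
  intros Hf Hn.
  apply (Ck_comp k U (fun x _ => x <> 0) (fun x _ => / x) f (fun _ _ => 0));
    [apply Ck_inv_fst|exact Hf|apply Ck_const|exact Hn].
Qed.

Lemma Ck_div k U f g :
  Ck k U f -> Ck k U g -> (forall x y, U x y -> g x y <> 0) ->
  Ck k U (fun x y => f x y / g x y).
Proof. intros Hf Hg Hn; apply Ck_mult; [exact Hf|now apply Ck_inv]. Qed.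

Lemma Ck_sqrt_fst k : Ck k (fun x _ => 0 < x) (fun x _ => sqrt x).
Proof.
  induction k as [|k IH].
  - intros x y Hx; apply (continuity_1d_2d_pt_comp sqrt (fun u _ => u));
      [|apply continuity_2d_pt_id1].
    apply continuity_pt_sqrt; lra.
  - exists (fun x _ => / (2 * sqrt x)), (fun _ _ => 0).
    split; [|split; [|apply Ck_const]].
    + intros x y Hx; apply differentiable_pt_lim_proj1_0.
      now apply derivable_pt_lim_sqrt.
    + apply Ck_inv; [apply Ck_mult; [apply Ck_const|exact IH]|].
      intros x _ Hx; pose proof (sqrt_lt_R0 x Hx); lra.
Qed.

Lemma Ck_sqrt k U f :
  Ck k U f -> (forall x y, U x y -> 0 < f x y) -> Ck k U (fun x y => sqrt (f x y)).
Proof.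
  intros Hf Hn.
  apply (Ck_comp k U (fun x _ => 0 < x) (fun x _ => sqrt x) f (fun _ _ => 0));
    [apply Ck_sqrt_fst|exact Hf|apply Ck_const|exact Hn].
Qed.

(** * Regular injective maps are diffeomorphisms onto their image *)

(** Extreme value theorem by contradiction. With - L the infimum of h on the box, if it is not
    attained then h > - L everywhere there; compactness turns this into a uniform gap e, so L - e
    would still bound the values of - h. *)
Lemma continuous_box_min (h : R -> R -> R) a b c d :
  a <= b -> c <= d ->
  (forall x y, a <= x <= b -> c <= y <= d -> continuity_2d_pt h x y) ->
  (forall x y, 0 <= h x y) ->
  exists x0 y0, a <= x0 <= b /\ c <= y0 <= d /\
    forall x y, a <= x <= b -> c <= y <= d -> h x0 y0 <= h x y.
Proof.
  intros Hab Hcd Hc Hpos.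
  set (S := fun z => exists x y, a <= x <= b /\ c <= y <= d /\ z = - h x y).
  destruct (completeness S) as [L [HL1 HL2]].
  { exists 0; intros z (x & y & _ & _ & ->); specialize (Hpos x y); lra. }
  { exists (- h a c), a, c; repeat split; lra. }
  apply NNPP; intros Hno.
  assert (Hgt : forall x y, a <= x <= b -> c <= y <= d -> - L < h x y).
  { intros x y Hx Hy; apply Rnot_le_lt; intros Hle; apply Hno.
    exists x, y; repeat split; try tauto.
    intros x' y' Hx' Hy'.
    assert (- h x' y' <= L) by (apply HL1; exists x', y'; tauto); lra. }
  (* The radius is at most half the gap h u v + L, and on the square of that radius h stays above -
     L plus that same half gap. A uniform lower bound e on the radii then gives h > - L + e. *)
  assert (Hd : forall u v, exists dl : posreal, a <= u <= b -> c <= v <= d ->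
    dl <= (h u v + L) / 2 /\
    forall x y, Rabs (x - u) < dl -> Rabs (y - v) < dl -> (h u v - L) / 2 < h x y).
  { intros u v.
    destruct (classic (a <= u <= b /\ c <= v <= d)) as [[Hu Hv]|Hn].
    - pose proof (Hgt u v Hu Hv) as Hp.
      assert (He : 0 < (h u v + L) / 2) by lra.
      destruct (Hc u v Hu Hv (mkposreal _ He)) as [dl Hdl]; simpl in Hdl.
      assert (Hm : 0 < Rmin dl ((h u v + L) / 2)).
      { apply Rmin_pos; [apply cond_pos|lra]. }
      pose proof (Rmin_l dl ((h u v + L) / 2)).
      exists (mkposreal _ Hm); intros _ _; simpl; split; [apply Rmin_r|].
      intros x y Hx Hy.
      specialize (Hdl x y ltac:(lra) ltac:(lra)).
      apply Rabs_def2 in Hdl; lra.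
    - exists (mkposreal 1 Rlt_0_1); tauto. }
  set (delta := fun u v => proj1_sig (constructive_indefinite_description _ (Hd u v))).
  destruct (compactness_value_2d a b c d delta) as [e He].
  assert (Hub : L <= L - e).
  { apply HL2; intros z (x & y & Hx & Hy & ->).
    apply Rnot_lt_le; intros Hlt; apply (He x y Hx Hy).
    intros (u & v & Hu & Hv & Hxu & Hyv & Hde); unfold delta in *.
    destruct (constructive_indefinite_description _ (Hd u v)) as [dl Hdl]; simpl in *.
    destruct (Hdl Hu Hv) as [H1 H2]; specialize (H2 x y Hxu Hyv); lra. }
  pose proof (cond_pos e); lra.
Qed.

Definition regular_2d (U : R -> R -> Prop) (f g : R -> R -> R) : Prop :=
  forall x y, U x y -> exists a b c d,
    differentiable_pt_lim f x y a b /\ differentiable_pt_lim g x y c d /\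
    a * d - b * c <> 0.

Definition injective_2d (U : R -> R -> Prop) (f g : R -> R -> R) : Prop :=
  forall x y x' y', U x y -> U x' y' -> f x y = f x' y' -> g x y = g x' y' ->
    x = x' /\ y = y'.

Lemma regular_2d_continuity U f g x y :
  regular_2d U f g -> U x y -> continuity_2d_pt f x y /\ continuity_2d_pt g x y.
Proof.
  intros H Hxy; destruct (H x y Hxy) as (a & b & c & d & Hf & Hg & _).
  split; eapply differentiable_pt_lim_continuity_2d; eassumption.
Qed.

Lemma continuity_2d_pt_sqdist f g u v x y :
  continuity_2d_pt f x y -> continuity_2d_pt g x y ->
  continuity_2d_pt (fun x y => (f x y - u) * (f x y - u) + (g x y - v) * (g x y - v)) x y.
Proof.
  intros Hf Hg.
  assert (continuity_2d_pt (fun x y => f x y - u) x y).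
  { apply continuity_2d_pt_minus; [exact Hf|apply continuity_2d_pt_const]. }
  assert (continuity_2d_pt (fun x y => g x y - v) x y).
  { apply continuity_2d_pt_minus; [exact Hg|apply continuity_2d_pt_const]. }
  apply continuity_2d_pt_plus; now apply continuity_2d_pt_mult.
Qed.

(** Injectivity makes the squared distance positive off (x0, y0), and compactness makes its minimum
    positive. The box may be degenerate: it is applied to the four edges of a square centred at (x0,
    y0). *)
Lemma sqdist_bounded_below U f g a b c d x0 y0 :
  a <= b -> c <= d -> regular_2d U f g -> injective_2d U f g -> U x0 y0 ->
  (forall x y, a <= x <= b -> c <= y <= d -> U x y /\ ~ (x = x0 /\ y = y0)) ->
  exists e, 0 < e /\ forall x y, a <= x <= b -> c <= y <= d ->
    e <= (f x y - f x0 y0) * (f x y - f x0 y0) + (g x y - g x0 y0) * (g x y - g x0 y0).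
Proof.
  intros Hab Hcd Hr Hi H0 Hbox.
  destruct (continuous_box_min
    (fun x y => (f x y - f x0 y0) * (f x y - f x0 y0) +
                (g x y - g x0 y0) * (g x y - g x0 y0)) a b c d)
    as (x1 & y1 & Hx1 & Hy1 & Hmin); trivial.
  - intros x y Hx Hy.
    destruct (regular_2d_continuity U f g x y Hr); [now apply Hbox|].
    now apply continuity_2d_pt_sqdist.
  - intros x y; apply Rplus_le_le_0_compat; apply Rle_0_sqr.
  - eexists; split; [|exact Hmin].
    cbv beta; destruct (Hbox x1 y1 Hx1 Hy1) as [HU1 Hne].
    destruct (Req_dec (f x1 y1) (f x0 y0)) as [Hf|Hf].
    + destruct (Req_dec (g x1 y1) (g x0 y0)) as [Hg|Hg].
      * exfalso; apply Hne; now apply Hi.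
      * apply Rplus_le_lt_0_compat; [apply Rle_0_sqr|].
        apply Rsqr_pos_lt; lra.
    + apply Rplus_lt_le_0_compat; [|apply Rle_0_sqr].
      apply Rsqr_pos_lt; lra.
Qed.

(* A small box around the point is mapped away from the image of the point on
   its boundary; for a nearby target (u, v) the squared distance to (u, v) is
   then minimal at an interior point, where regularity makes it vanish. *)
Lemma injective_regular_open_map U f g x0 y0 (eps : posreal) :
  open_2d U -> regular_2d U f g -> injective_2d U f g -> U x0 y0 ->
  exists delta : posreal, forall u v,
    Rabs (u - f x0 y0) < delta -> Rabs (v - g x0 y0) < delta ->
    exists x y, U x y /\ Rabs (x - x0) < eps /\ Rabs (y - y0) < eps /\
      f x y = u /\ g x y = v.
Proof.
  intros HU Hr Hi H0.
  destruct (HU x0 y0 H0) as [d0 Hd0].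
  set (r := Rmin d0 eps / 2).
  assert (Hrpos : 0 < r).
  { unfold r; pose proof (Rmin_pos d0 eps (cond_pos d0) (cond_pos eps)); lra. }
  assert (Hr0 : r < d0 /\ r < eps).
  { unfold r in *; pose proof (Rmin_l d0 eps); pose proof (Rmin_r d0 eps); lra. }
  assert (HboxU : forall x y, x0 - r <= x <= x0 + r -> y0 - r <= y <= y0 + r -> U x y).
  { intros x y Hx Hy; apply Hd0; apply Rabs_def1; lra. }
  destruct (sqdist_bounded_below U f g (x0 - r) (x0 - r) (y0 - r) (y0 + r) x0 y0)
    as (e1 & He1 & He1'); trivial; try lra.
  { intros x y Hx Hy; split; [apply HboxU|]; lra. }
  destruct (sqdist_bounded_below U f g (x0 + r) (x0 + r) (y0 - r) (y0 + r) x0 y0)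
    as (e2 & He2 & He2'); trivial; try lra.
  { intros x y Hx Hy; split; [apply HboxU|]; lra. }
  destruct (sqdist_bounded_below U f g (x0 - r) (x0 + r) (y0 - r) (y0 - r) x0 y0)
    as (e3 & He3 & He3'); trivial; try lra.
  { intros x y Hx Hy; split; [apply HboxU|]; lra. }
  destruct (sqdist_bounded_below U f g (x0 - r) (x0 + r) (y0 + r) (y0 + r) x0 y0)
    as (e4 & He4 & He4'); trivial; try lra.
  { intros x y Hx Hy; split; [apply HboxU|]; lra. }
  set (e := Rmin (Rmin e1 e2) (Rmin e3 e4)).
  assert (He : 0 < e) by (unfold e; repeat apply Rmin_pos; assumption).
  assert (Hei : e <= e1 /\ e <= e2 /\ e <= e3 /\ e <= e4).
  { unfold e; pose proof (Rmin_l e1 e2); pose proof (Rmin_r e1 e2).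
    pose proof (Rmin_l e3 e4); pose proof (Rmin_r e3 e4).
    pose proof (Rmin_l (Rmin e1 e2) (Rmin e3 e4)).
    pose proof (Rmin_r (Rmin e1 e2) (Rmin e3 e4)); lra. }
  (* With each coordinate of the target within sqrt (e / 8), the squared distance at the centre is
     below e / 4. If the minimum lay on an edge, then |A + B|^2 <= 2 |A|^2 + 2 |B|^2 would put the
     edge's image at squared distance below e from the image of the centre. *)
  assert (Hdl : 0 < sqrt (e / 8)) by (apply sqrt_lt_R0; lra).
  assert (Hdl2 : sqrt (e / 8) * sqrt (e / 8) = e / 8) by (apply sqrt_sqrt; lra).
  exists (mkposreal _ Hdl); simpl; intros u v Hu Hv.
  apply Rabs_def2 in Hu; apply Rabs_def2 in Hv.
  assert (Hu2 : (u - f x0 y0) * (u - f x0 y0) < e / 8) by nra.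
  assert (Hv2 : (v - g x0 y0) * (v - g x0 y0) < e / 8) by nra.
  set (h := fun x y => (f x y - u) * (f x y - u) + (g x y - v) * (g x y - v)).
  destruct (continuous_box_min h (x0 - r) (x0 + r) (y0 - r) (y0 + r))
    as (x1 & y1 & Hx1 & Hy1 & Hmin); try lra.
  { intros x y Hx Hy.
    destruct (regular_2d_continuity U f g x y Hr (HboxU x y Hx Hy)).
    now apply continuity_2d_pt_sqdist. }
  { intros x y; apply Rplus_le_le_0_compat; apply Rle_0_sqr. }
  assert (Hlow : h x1 y1 < e / 4).
  { apply Rle_lt_trans with (h x0 y0); [apply Hmin; lra|unfold h; nra]. }
  assert (Hedge : ~ e <= (f x1 y1 - f x0 y0) * (f x1 y1 - f x0 y0) +
                         (g x1 y1 - g x0 y0) * (g x1 y1 - g x0 y0)).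
  { unfold h in Hlow; intros Hge.
    pose proof (Rle_0_sqr ((f x1 y1 - u) - (u - f x0 y0))) as Q1.
    pose proof (Rle_0_sqr ((g x1 y1 - v) - (v - g x0 y0))) as Q2.
    unfold Rsqr in *; nra. }
  assert (Hx1' : x0 - r < x1 < x0 + r).
  { split; apply Rnot_le_lt; intros Hle; apply Hedge;
      [apply Rle_trans with e1|apply Rle_trans with e2]; try tauto;
      [apply He1'|apply He2']; lra. }
  assert (Hy1' : y0 - r < y1 < y0 + r).
  { split; apply Rnot_le_lt; intros Hle; apply Hedge;
      [apply Rle_trans with e3|apply Rle_trans with e4]; try tauto;
      [apply He3'|apply He4']; lra. }
  exists x1, y1; split; [now apply HboxU|].
  split; [apply Rabs_def1; lra|]; split; [apply Rabs_def1; lra|].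
  destruct (Hr x1 y1 (HboxU x1 y1 Hx1 Hy1)) as (a & b & c & d & Hf & Hg & Hdet).
  assert (Hfu : differentiable_pt_lim (fun x y => f x y - u) x1 y1 (a + 0) (b + 0)).
  { apply (differentiable_pt_lim_plus f (fun _ _ => - u)); [exact Hf|].
    apply differentiable_pt_lim_const. }
  assert (Hgv : differentiable_pt_lim (fun x y => g x y - v) x1 y1 (c + 0) (d + 0)).
  { apply (differentiable_pt_lim_plus g (fun _ _ => - v)); [exact Hg|].
    apply differentiable_pt_lim_const. }
  pose proof (differentiable_pt_lim_plus _ _ _ _ _ _ _ _
    (differentiable_pt_lim_mult _ _ _ _ _ _ _ _ Hfu Hfu)
    (differentiable_pt_lim_mult _ _ _ _ _ _ _ _ Hgv Hgv)) as Hh.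
  cbv beta in Hh.
  pose proof (derivable_pt_lim_comp_2d _ (fun t => t) (fun _ => y1) x1 _ _ _ _ Hh
    (derivable_pt_lim_id x1) (derivable_pt_lim_const y1 x1)) as Dx.
  pose proof (derivable_pt_lim_comp_2d _ (fun _ => x1) (fun t => t) y1 _ _ _ _ Hh
    (derivable_pt_lim_const x1 y1) (derivable_pt_lim_id y1)) as Dy.
  cbv beta in Dx, Dy.
  pose proof (deriv_minimum _ _ _ _ (exist _ _ Dx) (proj1 Hx1') (proj2 Hx1')
    (fun x Hxa Hxb => Hmin x y1 (conj (Rlt_le _ _ Hxa) (Rlt_le _ _ Hxb)) Hy1)) as Ex.
  pose proof (deriv_minimum _ _ _ _ (exist _ _ Dy) (proj1 Hy1') (proj2 Hy1')
    (fun y Hya Hyb => Hmin x1 y Hx1 (conj (Rlt_le _ _ Hya) (Rlt_le _ _ Hyb)))) as Ey.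
  simpl in Ex, Ey.
  set (X := f x1 y1 - u) in *; set (Y := g x1 y1 - v) in *.
  (* Half the gradient of the squared distance is the transposed Jacobian applied to the residual
     (X, Y). It vanishes at the interior minimum, and the determinant then forces X = Y = 0. *)
  assert (E1 : a * X + c * Y = 0) by lra.
  assert (E2 : b * X + d * Y = 0) by lra.
  assert (EX : (a * d - b * c) * X = 0).
  { replace ((a * d - b * c) * X) with (d * (a * X + c * Y) - c * (b * X + d * Y)) by ring.
    rewrite E1, E2; ring. }
  assert (EY : (a * d - b * c) * Y = 0).
  { replace ((a * d - b * c) * Y) with (a * (b * X + d * Y) - b * (a * X + c * Y)) by ring.
    rewrite E1, E2; ring. }
  apply Rmult_integral in EX; apply Rmult_integral in EY.
  unfold X, Y in *; split; lra.
Qed.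

Lemma Rabs_lin_le p q z w B :
  Rabs z <= B -> Rabs w <= B -> Rabs (p * z + q * w) <= (Rabs p + Rabs q) * B.
Proof.
  intros Hz Hw.
  apply Rle_trans with (1 := Rabs_triang _ _); rewrite !Rabs_mult.
  pose proof (Rabs_pos p); pose proof (Rabs_pos q); nra.
Qed.

(** Solving the linearised equations for the increment (X, Y) of the inverse gives the inverse
    Jacobian matrix plus an error controlled by the size mu of (X, Y). Continuity of p and q makes
    that error small relative to mu; it remains to compare mu with the size nu of the increment of
    (u, v). *)
Lemma differentiable_pt_lim_inverse f g p q u0 v0 a b c d :
  differentiable_pt_lim f (p u0 v0) (q u0 v0) a b ->
  differentiable_pt_lim g (p u0 v0) (q u0 v0) c d ->
  a * d - b * c <> 0 ->
  continuity_2d_pt p u0 v0 -> continuity_2d_pt q u0 v0 ->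
  locally_2d (fun u v => f (p u v) (q u v) = u /\ g (p u v) (q u v) = v) u0 v0 ->
  differentiable_pt_lim p u0 v0 (d / (a * d - b * c)) (- b / (a * d - b * c)) /\
  differentiable_pt_lim q u0 v0 (- c / (a * d - b * c)) (a / (a * d - b * c)).
Proof.
  intros Hf Hg Hdet Hp Hq Hinv.
  set (D := a * d - b * c) in *.
  set (x0 := p u0 v0) in *; set (y0 := q u0 v0) in *.
  (* C bounds the norm of the inverse Jacobian for the maximum norm; the added 1 ensures C >= 1. *)
  set (C := (Rabs a + Rabs b + Rabs c + Rabs d) / Rabs D + 1).
  assert (HD : 0 < Rabs D) by now apply Rabs_pos_lt.
  pose proof (Rabs_pos a); pose proof (Rabs_pos b);
    pose proof (Rabs_pos c); pose proof (Rabs_pos d).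
  assert (HiD : 0 < / Rabs D) by now apply Rinv_0_lt_compat.
  assert (HC : 1 <= C) by (unfold C, Rdiv; nra).
  assert (key : forall eps : posreal, locally_2d (fun u v =>
    let nu := Rmax (Rabs (u - u0)) (Rabs (v - v0)) in
    Rabs (p u v - x0 - (d / D * (u - u0) + - b / D * (v - v0))) <= eps * nu /\
    Rabs (q u v - y0 - (- c / D * (u - u0) + a / D * (v - v0))) <= eps * nu) u0 v0).
  { intros eps; pose proof (cond_pos eps) as Heps.
    (* The first bound gives C * eta <= 1/2, so that the error can be absorbed into mu; the second
       turns the resulting error C * eta * (2 * C * nu) into eps * nu. *)
    set (eta := Rmin (/ (2 * C)) (eps / (2 * C * C))).
    assert (Heta : 0 < eta).
    { apply Rmin_pos; [apply Rinv_0_lt_compat; lra|].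
      apply Rdiv_lt_0_compat; nra. }
    assert (Heta1 : C * eta <= / 2).
    { apply Rle_trans with (C * / (2 * C)).
      - apply Rmult_le_compat_l; [lra|apply Rmin_l].
      - right; field; lra. }
    assert (Heta2 : C * eta * (2 * C) <= eps).
    { apply Rle_trans with (C * (eps / (2 * C * C)) * (2 * C)).
      - apply Rmult_le_compat_r; [lra|].
        apply Rmult_le_compat_l; [lra|apply Rmin_r].
      - right; field; lra. }
    destruct (Hf (mkposreal _ Heta)) as [d1 Hd1].
    destruct (Hg (mkposreal _ Heta)) as [d2 Hd2]; simpl in Hd1, Hd2.
    destruct (Hp (mkposreal _ (Rmin_pos _ _ (cond_pos d1) (cond_pos d2)))) as [d3 Hd3].
    destruct (Hq (mkposreal _ (Rmin_pos _ _ (cond_pos d1) (cond_pos d2)))) as [d4 Hd4].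
    simpl in Hd3, Hd4.
    destruct Hinv as [d5 Hd5].
    exists (mkposreal _ (Rmin_pos _ _ (Rmin_pos _ _ (cond_pos d3) (cond_pos d4)) (cond_pos d5))).
    simpl; intros u v Hu Hv.
    pose proof (Rmin_l (Rmin d3 d4) d5); pose proof (Rmin_r (Rmin d3 d4) d5).
    pose proof (Rmin_l d3 d4); pose proof (Rmin_r d3 d4).
    pose proof (Rmin_l d1 d2); pose proof (Rmin_r d1 d2).
    destruct (Hd5 u v) as [E1 E2]; try lra.
    destruct (Hd5 u0 v0) as [F1 F2];
      try (rewrite Rminus_eq_0, Rabs_R0; apply cond_pos).
    specialize (Hd3 u v ltac:(lra) ltac:(lra)); specialize (Hd4 u v ltac:(lra) ltac:(lra)).
    fold x0 in Hd3; fold y0 in Hd4.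
    specialize (Hd1 (p u v) (q u v) ltac:(lra) ltac:(lra)).
    specialize (Hd2 (p u v) (q u v) ltac:(lra) ltac:(lra)).
    fold x0 y0 in F1, F2.
    rewrite E1, F1 in Hd1; rewrite E2, F2 in Hd2.
    set (X := p u v - x0) in *; set (Y := q u v - y0) in *.
    set (mu := Rmax (Rabs X) (Rabs Y)) in *.
    set (nu := Rmax (Rabs (u - u0)) (Rabs (v - v0))) in *.
    set (r1 := u - u0 - (a * X + b * Y)) in *.
    set (r2 := v - v0 - (c * X + d * Y)) in *.
    assert (Hmu : 0 <= mu) by (apply Rle_trans with (2 := Rmax_l _ _), Rabs_pos).
    assert (Hnu : 0 <= nu) by (apply Rle_trans with (2 := Rmax_l _ _), Rabs_pos).
    assert (Hnu1 : Rabs (u - u0) <= nu) by apply Rmax_l.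
    assert (Hnu2 : Rabs (v - v0) <= nu) by apply Rmax_r.
    assert (Hlin : forall k l z w B, 0 <= B -> Rabs z <= B -> Rabs w <= B ->
      (Rabs k + Rabs l) / Rabs D <= C -> Rabs (k / D * z + l / D * w) <= C * B).
    { intros k l z w B HB Hz Hw Hkl.
      apply Rle_trans with (1 := Rabs_lin_le _ _ _ _ _ Hz Hw).
      apply Rmult_le_compat_r; [exact HB|].
      unfold Rdiv; rewrite !Rabs_mult, Rabs_inv; unfold Rdiv in Hkl; lra. }
    assert (Hdb : (Rabs d + Rabs (- b)) / Rabs D <= C)
      by (rewrite Rabs_Ropp; unfold C, Rdiv; nra).
    assert (Hca : (Rabs (- c) + Rabs a) / Rabs D <= C)
      by (rewrite Rabs_Ropp; unfold C, Rdiv; nra).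
    assert (EX : X - (d / D * (u - u0) + - b / D * (v - v0)) =
                 - (d / D * r1 + - b / D * r2)).
    { unfold r1, r2, D; field; exact Hdet. }
    assert (EY : Y - (- c / D * (u - u0) + a / D * (v - v0)) =
                 - (- c / D * r1 + a / D * r2)).
    { unfold r1, r2, D; field; exact Hdet. }
    assert (Hem : 0 <= eta * mu) by (apply Rmult_le_pos; lra).
    assert (BX : Rabs (X - (d / D * (u - u0) + - b / D * (v - v0))) <= C * (eta * mu)).
    { rewrite EX, Rabs_Ropp; now apply Hlin. }
    assert (BY : Rabs (Y - (- c / D * (u - u0) + a / D * (v - v0))) <= C * (eta * mu)).
    { rewrite EY, Rabs_Ropp; now apply Hlin. }
    (* Here mu <= C * nu + C * eta * mu with C * eta <= 1/2, so the last term is absorbed on the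
       left. *)
    assert (Hmunu : mu <= 2 * C * nu).
    { assert (Hmu2 : mu <= C * nu + C * (eta * mu)).
      { unfold mu at 1; apply Rmax_lub.
        - pose proof (Hlin d (- b) (u - u0) (v - v0) nu Hnu Hnu1 Hnu2 Hdb) as HL.
          pose proof (Rabs_triang (X - (d / D * (u - u0) + - b / D * (v - v0)))
            (d / D * (u - u0) + - b / D * (v - v0))) as HT.
          match type of HT with Rabs ?z <= _ => replace z with X in HT by ring end.
          lra.
        - pose proof (Hlin (- c) a (u - u0) (v - v0) nu Hnu Hnu1 Hnu2 Hca) as HL.
          pose proof (Rabs_triang (Y - (- c / D * (u - u0) + a / D * (v - v0)))
            (- c / D * (u - u0) + a / D * (v - v0))) as HT.
          match type of HT with Rabs ?z <= _ => replace z with Y in HT by ring end.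
          lra. }
      nra. }
    assert (Hfin : C * (eta * mu) <= eps * nu).
    { apply Rle_trans with (C * eta * (2 * C) * nu).
      - replace (C * (eta * mu)) with (C * eta * mu) by ring.
        replace (C * eta * (2 * C) * nu) with (C * eta * (2 * C * nu)) by ring.
        apply Rmult_le_compat_l; [nra|exact Hmunu].
      - now apply Rmult_le_compat_r. }
    split; lra. }
  split; intros eps; destruct (key eps) as [dl Hdl]; exists dl;
    intros u v Hu Hv; now apply Hdl.
Qed.

(** Bootstrap from continuity: the partials of p and q are rational expressions in the partials of f
    and g evaluated at (p, q). Hence order k for both p and q gives order k + 1, and the two must be
    treated together. *)
Lemma Ck_inverse k U V f g p q :
  open_2d V ->
  (forall j, Ck j U f) -> (forall j, Ck j U g) -> regular_2d U f g ->
  (forall u v, V u v -> U (p u v) (q u v)) ->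
  (forall u v, V u v -> f (p u v) (q u v) = u /\ g (p u v) (q u v) = v) ->
  (forall u v, V u v -> continuity_2d_pt p u v /\ continuity_2d_pt q u v) ->
  Ck k V p /\ Ck k V q.
Proof.
  intros HV Hf Hg Hr HVU Hinv Hc.
  induction k as [|k [IHp IHq]].
  { split; intros u v Huv; now apply Hc. }
  destruct (Hf (S k)) as (fx & fy & Df & Hfx & Hfy).
  destruct (Hg (S k)) as (gx & gy & Dg & Hgx & Hgy).
  assert (Hdet : forall x y, U x y -> fx x y * gy x y - fy x y * gx x y <> 0).
  { intros x y Hxy; destruct (Hr x y Hxy) as (a & b & c & d & Ha & Hb & Hd).
    destruct (differentiable_pt_lim_uniq _ _ _ _ _ _ _ Ha (Df x y Hxy)) as [<- <-].
    destruct (differentiable_pt_lim_uniq _ _ _ _ _ _ _ Hb (Dg x y Hxy)) as [<- <-].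
    exact Hd. }
  assert (Hcomp : forall h, Ck k U h -> Ck k V (fun u v => h (p u v) (q u v))).
  { intros h Hh; now apply (Ck_comp k V U). }
  set (D := fun x y => fx x y * gy x y - fy x y * gx x y).
  assert (HD : Ck k U D) by (apply Ck_minus; now apply Ck_mult).
  assert (Hd : forall u v, V u v ->
    differentiable_pt_lim p u v (gy (p u v) (q u v) / D (p u v) (q u v))
      (- fy (p u v) (q u v) / D (p u v) (q u v)) /\
    differentiable_pt_lim q u v (- gx (p u v) (q u v) / D (p u v) (q u v))
      (fx (p u v) (q u v) / D (p u v) (q u v))).
  { intros u v Huv; apply (differentiable_pt_lim_inverse f g); auto; try now apply Hc.
    destruct (HV u v Huv) as [dl Hdl]; exists dl; intros; apply Hinv; auto. }
  split.
  - exists (fun u v => gy (p u v) (q u v) / D (p u v) (q u v)),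
      (fun u v => - fy (p u v) (q u v) / D (p u v) (q u v)).
    split; [intros; now apply Hd|].
    split; [apply (Hcomp (fun x y => gy x y / D x y))
           |apply (Hcomp (fun x y => - fy x y / D x y))];
      apply Ck_div; auto; now apply Ck_opp.
  - exists (fun u v => - gx (p u v) (q u v) / D (p u v) (q u v)),
      (fun u v => fx (p u v) (q u v) / D (p u v) (q u v)).
    split; [intros; now apply Hd|].
    split; [apply (Hcomp (fun x y => - gx x y / D x y))
           |apply (Hcomp (fun x y => fx x y / D x y))];
      apply Ck_div; auto; now apply Ck_opp.
Qed.

(** The inverse is picked by [epsilon], with a default that can matter only off V. Openness of V and
    continuity of the inverse both come from [injective_regular_open_map]; smoothness then follows
    by [Ck_inverse]. *)
Theorem regular_injective_diffeomorphism U V F :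
  open_2d U -> smooth_map_on U F ->
  regular_2d U (fun x y => fst (F x y)) (fun x y => snd (F x y)) ->
  injective_2d U (fun x y => fst (F x y)) (fun x y => snd (F x y)) ->
  (forall u v, V u v <-> exists x y, U x y /\ F x y = (u, v)) ->
  open_2d V /\ diffeomorphism U V F.
Proof.
  intros HU [Hf Hg] Hr Hi HV.
  set (f := fun x y => fst (F x y)) in *; set (g := fun x y => snd (F x y)) in *.
  assert (HVo : open_2d V).
  { intros u v Huv; apply HV in Huv; destruct Huv as (x & y & Hxy & HF).
    destruct (injective_regular_open_map U f g x y (mkposreal 1 Rlt_0_1)) as [dl Hdl]; auto.
    unfold f, g in Hdl; rewrite HF in Hdl; simpl in Hdl.
    exists dl; intros u' v' Hu Hv; apply HV.
    destruct (Hdl u' v' Hu Hv) as (x' & y' & HU' & _ & _ & <- & <-).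
    exists x', y'; split; [exact HU'|apply surjective_pairing]. }
  split; [exact HVo|].
  set (G := fun u v => epsilon (inhabits (0, 0))
    (fun z : R * R => U (fst z) (snd z) /\ F (fst z) (snd z) = (u, v))).
  assert (HG : forall u v, V u v ->
    U (fst (G u v)) (snd (G u v)) /\ F (fst (G u v)) (snd (G u v)) = (u, v)).
  { intros u v Huv; unfold G; apply epsilon_spec.
    apply HV in Huv; destruct Huv as (x & y & H); now exists (x, y). }
  assert (HGF : forall x y, U x y -> G (f x y) (g x y) = (x, y)).
  { intros x y Hxy.
    destruct (HG (f x y) (g x y)) as [H1 H2].
    { apply HV; exists x, y; split; [exact Hxy|apply surjective_pairing]. }
    destruct (Hi _ _ x y H1 Hxy) as [E1 E2]; unfold f, g in *; try now rewrite H2.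
    rewrite (surjective_pairing (G _ _)); now rewrite E1, E2. }
  assert (Hcont : forall u v, V u v ->
    continuity_2d_pt (fun u v => fst (G u v)) u v /\
    continuity_2d_pt (fun u v => snd (G u v)) u v).
  { intros u v Huv; destruct (HG u v Huv) as [H1 H2].
    (* The open mapping lemma finds a preimage of (u', v') within eps of G u v. By injectivity this
       preimage is G u' v'. *)
    assert (key : forall eps : posreal, locally_2d (fun u' v' =>
      Rabs (fst (G u' v') - fst (G u v)) < eps /\
      Rabs (snd (G u' v') - snd (G u v)) < eps) u v).
    { intros eps.
      destruct (injective_regular_open_map U f g _ _ eps HU Hr Hi H1) as [dl Hdl].
      unfold f, g in Hdl; rewrite H2 in Hdl; simpl in Hdl.
      exists dl; intros u' v' Hu Hv.
      destruct (Hdl u' v' Hu Hv) as (x & y & Hxy & Hx & Hy & <- & <-).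
      rewrite (HGF x y Hxy : G (fst (F x y)) (snd (F x y)) = _); now split. }
    split; intros eps; destruct (key eps) as [dl Hdl]; exists dl; intros; now apply Hdl. }
  assert (Hck : forall k, Ck k V (fun u v => fst (G u v)) /\ Ck k V (fun u v => snd (G u v))).
  { intros k; apply (Ck_inverse k U V f g); auto.
    - intros u v Huv; now apply HG.
    - intros u v Huv; unfold f, g; destruct (HG u v Huv) as [_ H2]; now rewrite H2. }
  split; [|split; [now split|]].
  - intros x y Hxy; apply HV; exists x, y; split; [exact Hxy|apply surjective_pairing].
  - exists G; repeat split.
    + intros u v Huv; now apply HG.
    + exact HGF.
    + intros u v Huv; now apply HG.
    + intros k; apply Hck.
    + intros k; apply Hck.
Qed.

(** On V the map L is F composed with the inverse of H, so its smoothness is inherited without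
    differentiating L itself. In the application L is [Psi]. *)
Lemma diffeomorphism_factor U V W H F L :
  open_2d V -> diffeomorphism U V H -> diffeomorphism U W F ->
  (forall x y, U x y -> L (fst (H x y)) (snd (H x y)) = F x y) ->
  diffeomorphism V W L.
Proof.
  intros HV (HUV & HH & H' & H'1 & H'2 & H'3 & HH')
    (HUW & HF & F' & F'1 & F'2 & F'3 & HF') HL.
  assert (EL : forall u v, V u v -> L u v = F (fst (H' u v)) (snd (H' u v))).
  { intros u v Huv; rewrite <- HL by now apply H'1. now rewrite (H'3 u v Huv). }
  split; [|split].
  - intros u v Huv; rewrite EL by exact Huv; now apply HUW, H'1.
  - split; intros k; [apply (Ck_ext k V
      (fun u v => fst (F (fst (H' u v)) (snd (H' u v)))))
      |apply (Ck_ext k V (fun u v => snd (F (fst (H' u v)) (snd (H' u v)))))]; auto;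
      try (intros u v Huv; now rewrite EL).
    + apply (Ck_comp k V U (fun x y => fst (F x y))); auto; apply HF || apply HH'.
    + apply (Ck_comp k V U (fun x y => snd (F x y))); auto; apply HF || apply HH'.
  - exists (fun u v => H (fst (F' u v)) (snd (F' u v))); split; [|split; [|split]].
    + intros u v Huv; now apply HUV, F'1.
    + intros x y Hxy; rewrite EL by exact Hxy.
      rewrite F'2 by now apply H'1. now apply H'3.
    + intros u v Huv; rewrite HL by now apply F'1. now apply F'3.
    + split; intros k.
      * apply (Ck_comp k W U (fun x y => fst (H x y))); auto; apply HH || apply HF'.
      * apply (Ck_comp k W U (fun x y => snd (H x y))); auto; apply HH || apply HF'.
Qed.

(** * Complete elliptic integrals *)

(** The integral makes sense for every m < 1, negative m included, so m = 0 is an interior point at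
    which two-sided continuity can be stated. *)
Definition ellK (m : R) : R := RInt (fun t => / sqrt (1 - m * sin t ^ 2)) 0 (PI / 2).
Definition ellE (m : R) : R := RInt (fun t => sqrt (1 - m * sin t ^ 2)) 0 (PI / 2).

Lemma modulus_pos m t : m < 1 -> 0 < 1 - m * sin t ^ 2.
Proof.
  intros Hm; pose proof (sin2_cos2 t) as H; unfold Rsqr in H.
  pose proof (Rle_0_sqr (sin t)); pose proof (Rle_0_sqr (cos t)); unfold Rsqr in *.
  destruct (Rle_lt_dec m 0); nra.
Qed.

Lemma sqrt_modulus_pos m t : m < 1 -> 0 < sqrt (1 - m * sin t ^ 2).
Proof. intros Hm; now apply sqrt_lt_R0, modulus_pos. Qed.

Lemma sqrt_modulus_sqr m t : m < 1 ->
  sqrt (1 - m * sin t ^ 2) * sqrt (1 - m * sin t ^ 2) = 1 - m * sin t ^ 2.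
Proof. intros Hm; apply sqrt_sqrt, Rlt_le, modulus_pos, Hm. Qed.

Lemma continuous_sqrt_modulus m t : continuous (fun t => sqrt (1 - m * sin t ^ 2)) t.
Proof.
  apply (continuous_comp (fun t => 1 - m * sin t ^ 2) sqrt); [|apply continuous_sqrt].
  apply (ex_derive_continuous (fun t => 1 - m * sin t ^ 2)); auto_derive; trivial.
Qed.

Lemma continuous_inv_sqrt_modulus m t : m < 1 ->
  continuous (fun t => / sqrt (1 - m * sin t ^ 2)) t.
Proof.
  intros Hm; apply (continuous_comp (fun t => sqrt (1 - m * sin t ^ 2)) Rinv).
  - apply continuous_sqrt_modulus.
  - apply continuous_Rinv, Rgt_not_eq, sqrt_modulus_pos, Hm.
Qed.

Lemma is_RInt_ellK m : m < 1 ->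
  is_RInt (fun t => / sqrt (1 - m * sin t ^ 2)) 0 (PI / 2) (ellK m).
Proof.
  intros Hm; apply (RInt_correct (V := R_CompleteNormedModule)).
  apply (ex_RInt_continuous (V := R_CompleteNormedModule)).
  intros t _; now apply continuous_inv_sqrt_modulus.
Qed.

Lemma is_RInt_ellE m :
  is_RInt (fun t => sqrt (1 - m * sin t ^ 2)) 0 (PI / 2) (ellE m).
Proof.
  apply (RInt_correct (V := R_CompleteNormedModule)).
  apply (ex_RInt_continuous (V := R_CompleteNormedModule)).
  intros t _; now apply continuous_sqrt_modulus.
Qed.

Lemma continuity_2d_pt_sqrt_modulus m t :
  continuity_2d_pt (fun u v => sqrt (1 - u * sin v ^ 2)) m t.
Proof.
  apply (continuity_1d_2d_pt_comp sqrt (fun u v => 1 - u * sin v ^ 2)).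
  - apply continuity_pt_filterlim, (continuous_sqrt (1 - m * sin t ^ 2)).
  - apply continuity_2d_pt_minus; [apply continuity_2d_pt_const|].
    apply continuity_2d_pt_mult; [apply continuity_2d_pt_id1|].
    apply (continuity_1d_2d_pt_comp (fun v => sin v ^ 2) (fun _ v => v));
      [|apply continuity_2d_pt_id2].
    apply derivable_continuous_pt; reg.
Qed.

Lemma continuity_2d_pt_sin_sqr m t :
  continuity_2d_pt (fun _ v => sin v ^ 2) m t.
Proof.
  apply (continuity_1d_2d_pt_comp (fun v => sin v ^ 2) (fun _ v => v));
    [|apply continuity_2d_pt_id2].
  apply derivable_continuous_pt; reg.
Qed.

Lemma is_derive_inv_sqrt_modulus m t : m < 1 ->
  is_derive (fun u => / sqrt (1 - u * sin t ^ 2)) m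
    (sin t ^ 2 * / (2 * sqrt (1 - m * sin t ^ 2) ^ 3)).
Proof.
  intros Hm; pose proof (modulus_pos m t Hm); pose proof (sqrt_modulus_pos m t Hm).
  pose proof (sqrt_modulus_sqr m t Hm) as Hs.
  unfold Rminus in *; simpl in *.
  auto_derive; [repeat split; first [lra|apply Rgt_not_eq; lra]|].
  simpl; field; apply Rgt_not_eq; lra.
Qed.

Lemma is_derive_sqrt_modulus m t : m < 1 ->
  is_derive (fun u => sqrt (1 - u * sin t ^ 2)) m
    (- (sin t ^ 2 * / (2 * sqrt (1 - m * sin t ^ 2)))).
Proof.
  intros Hm; pose proof (modulus_pos m t Hm); pose proof (sqrt_modulus_pos m t Hm).
  unfold Rminus in *; simpl in *.
  auto_derive; [repeat split; first [lra|apply Rgt_not_eq; lra]|].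
  simpl; field; apply Rgt_not_eq; lra.
Qed.

Lemma locally_lt_1 m : m < 1 -> locally m (fun u => u < 1).
Proof. intros Hm; apply (open_lt 1 m Hm). Qed.

Lemma is_derive_ellK_RInt m : m < 1 ->
  is_derive ellK m
    (RInt (fun t => sin t ^ 2 * / (2 * sqrt (1 - m * sin t ^ 2) ^ 3)) 0 (PI / 2)).
Proof.
  intros Hm.
  (* Differentiation under the integral yields an integrand written with [Derive]; [RInt_ext] trades
     it for the explicit one. *)
  erewrite RInt_ext; [apply (is_derive_RInt_param
    (fun u t => / sqrt (1 - u * sin t ^ 2)) 0 (PI / 2) m)|].
  - apply filter_imp with (2 := locally_lt_1 m Hm); intros u Hu t _.
    eexists; now apply is_derive_inv_sqrt_modulus.
  - intros t _.
    apply (continuity_2d_pt_ext_loc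
      (fun u v => sin v ^ 2 * / (2 * sqrt (1 - u * sin v ^ 2) ^ 3))).
    + destruct (locally_lt_1 m Hm) as [dl Hdl]; exists dl; intros u v Hu _.
      symmetry; apply is_derive_unique, is_derive_inv_sqrt_modulus, Hdl, Hu.
    + apply continuity_2d_pt_mult; [apply continuity_2d_pt_sin_sqr|].
      pose proof (sqrt_modulus_pos m t Hm).
      apply continuity_2d_pt_inv.
      * apply continuity_2d_pt_mult; [apply continuity_2d_pt_const|].
        apply (continuity_1d_2d_pt_comp (fun z => z ^ 3)).
        -- apply derivable_continuous_pt; reg.
        -- apply continuity_2d_pt_sqrt_modulus.
      * apply Rgt_not_eq, Rmult_lt_0_compat; [lra|now apply pow_lt].
  - apply filter_imp with (2 := locally_lt_1 m Hm); intros u Hu.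
    eexists; now apply is_RInt_ellK.
  - intros t _; simpl; symmetry; apply is_derive_unique, (is_derive_inv_sqrt_modulus m t Hm).
Qed.

Lemma is_derive_ellE_RInt m : m < 1 ->
  is_derive ellE m
    (RInt (fun t => - (sin t ^ 2 * / (2 * sqrt (1 - m * sin t ^ 2)))) 0 (PI / 2)).
Proof.
  intros Hm.
  erewrite RInt_ext; [apply (is_derive_RInt_param
    (fun u t => sqrt (1 - u * sin t ^ 2)) 0 (PI / 2) m)|].
  - apply filter_imp with (2 := locally_lt_1 m Hm); intros u Hu t _.
    eexists; now apply is_derive_sqrt_modulus.
  - intros t _.
    apply (continuity_2d_pt_ext_loc
      (fun u v => - (sin v ^ 2 * / (2 * sqrt (1 - u * sin v ^ 2))))).
    + destruct (locally_lt_1 m Hm) as [dl Hdl]; exists dl; intros u v Hu _.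
      symmetry; apply is_derive_unique, is_derive_sqrt_modulus, Hdl, Hu.
    + apply continuity_2d_pt_opp, continuity_2d_pt_mult; [apply continuity_2d_pt_sin_sqr|].
      pose proof (sqrt_modulus_pos m t Hm).
      apply continuity_2d_pt_inv; [|lra].
      apply continuity_2d_pt_mult; [apply continuity_2d_pt_const|].
      apply continuity_2d_pt_sqrt_modulus.
  - apply filter_imp with (2 := locally_lt_1 m Hm); intros u Hu.
    eexists; now apply is_RInt_ellE.
  - intros t _; simpl; symmetry; apply is_derive_unique, (is_derive_sqrt_modulus m t Hm).
Qed.

Lemma continuous_ellK m : m < 1 -> continuous ellK m.
Proof.
  intros Hm; apply (ex_derive_continuous ellK); eexists; now apply is_derive_ellK_RInt.
Qed.

Lemma continuous_ellE m : m < 1 -> continuous ellE m.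
Proof.
  intros Hm; apply (ex_derive_continuous ellE); eexists; now apply is_derive_ellE_RInt.
Qed.

(* The integrand is the derivative of sin t cos t / sqrt (1 - m sin^2 t),
   which vanishes at both ends. *)
Lemma is_RInt_modulus_boundary m : m < 1 ->
  is_RInt (fun t => (1 - 2 * sin t ^ 2) / sqrt (1 - m * sin t ^ 2) +
    m * (sin t ^ 2 * (1 - sin t ^ 2) / sqrt (1 - m * sin t ^ 2) ^ 3)) 0 (PI / 2) 0.
Proof.
  intros Hm.
  set (phi := fun t => sin t * cos t / sqrt (1 - m * sin t ^ 2)).
  replace 0 with (minus (phi (PI / 2)) (phi 0)) at 2.
  2:{ unfold minus, plus, opp, phi; simpl; rewrite cos_PI2, sin_0; unfold Rdiv; ring. }
  apply (is_RInt_derive (V := R_CompleteNormedModule) phi).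
  - intros t _; unfold phi.
    pose proof (modulus_pos m t Hm); pose proof (sqrt_modulus_pos m t Hm).
    pose proof (sqrt_modulus_sqr m t Hm) as Hs.
    pose proof (sin2_cos2 t) as H2; unfold Rsqr in H2.
    unfold Rminus in *; simpl in *.
    auto_derive; [repeat split; first [lra|apply Rgt_not_eq; lra]|].
    simpl; set (D := sqrt (1 + - (m * (sin t * (sin t * 1))))) in *.
    assert (Hc : cos t * cos t = 1 - sin t * sin t) by lra.
    apply Rminus_diag_uniq.
    (* The two sides differ by a multiple of cos^2 t - (1 - sin^2 t). This factor is displayed
       because [field] does not know the Pythagorean identity. *)
    match goal with |- ?e = 0 => replace e with
      ((cos t * cos t - (1 - sin t * sin t)) *
       (/ D + m * (sin t * sin t) * / (D * (D * D)))) end.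
    + rewrite Hc; ring.
    + field; apply Rgt_not_eq; lra.
  - intros t _.
    assert (HD : continuous (fun t => sqrt (1 - m * sin t ^ 2)) t)
      by apply continuous_sqrt_modulus.
    pose proof (sqrt_modulus_pos m t Hm).
    apply (continuous_plus (V := R_NormedModule)).
    + apply (continuous_mult (K := R_AbsRing)).
      * apply (ex_derive_continuous (fun t => 1 - 2 * sin t ^ 2)); auto_derive; trivial.
      * now apply continuous_inv_sqrt_modulus.
    + apply (continuous_mult (K := R_AbsRing) (fun _ => m)); [apply continuous_const|].
      apply (continuous_mult (K := R_AbsRing) (fun t => sin t ^ 2 * (1 - sin t ^ 2))).
      * apply (ex_derive_continuous (fun t => sin t ^ 2 * (1 - sin t ^ 2))); auto_derive; trivial.
      * apply (continuous_comp (fun t => sqrt (1 - m * sin t ^ 2)) (fun z => / z ^ 3)); [exact HD|].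
        apply (ex_derive_continuous (fun z => / z ^ 3)); auto_derive.
        apply Rgt_not_eq; repeat apply Rmult_lt_0_compat; lra.
Qed.

(** The integrand sin^2 / (2 D^3), with D = sqrt (1 - m sin^2), is a combination of D, / D and the
    exact derivative in [is_RInt_modulus_boundary]. The last integrates to 0, which is why the term
    m * 0 is inserted. *)
Lemma is_derive_ellK m : 0 < m < 1 ->
  is_derive ellK m ((ellE m - (1 - m) * ellK m) / (2 * m * (1 - m))).
Proof.
  intros [Hm0 Hm].
  replace ((ellE m - (1 - m) * ellK m) / (2 * m * (1 - m))) with
    (RInt (fun t => sin t ^ 2 * / (2 * sqrt (1 - m * sin t ^ 2) ^ 3)) 0 (PI / 2));
    [now apply is_derive_ellK_RInt|].
  apply is_RInt_unique.
  set (c := / (2 * m * (1 - m))).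
  replace ((ellE m - (1 - m) * ellK m) / (2 * m * (1 - m)))
    with (c * ((ellE m - (1 - m) * ellK m) - m * 0)) by (unfold c; field; lra).
  pose proof (is_RInt_scal (V := R_NormedModule) _ _ _ c _
    (is_RInt_minus (V := R_NormedModule) _ _ _ _ _ _
      (is_RInt_minus (V := R_NormedModule) _ _ _ _ _ _ (is_RInt_ellE m)
        (is_RInt_scal (V := R_NormedModule) _ _ _ (1 - m) _ (is_RInt_ellK m Hm)))
      (is_RInt_scal (V := R_NormedModule) _ _ _ m _ (is_RInt_modulus_boundary m Hm)))) as H.
  eapply is_RInt_ext; [|exact H].
  intros t _; unfold scal, minus, plus, opp; simpl; unfold mult; simpl.
  pose proof (sqrt_modulus_pos m t Hm) as Hp; pose proof (sqrt_modulus_sqr m t Hm) as Hs.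
  simpl in Hp, Hs; set (D := sqrt (1 - m * (sin t * (sin t * 1)))) in *.
  set (x := sin t) in *; unfold c.
  (* Eliminating sin^2 in favour of D leaves a rational identity in D and m. *)
  assert (Hs' : x * x = (1 - D * D) / m) by (rewrite Hs; field; lra).
  rewrite !Rmult_1_r, Hs'; field; repeat split; lra.
Qed.

Lemma is_derive_ellE m : 0 < m < 1 ->
  is_derive ellE m ((ellE m - ellK m) / (2 * m)).
Proof.
  intros [Hm0 Hm].
  replace ((ellE m - ellK m) / (2 * m)) with
    (RInt (fun t => - (sin t ^ 2 * / (2 * sqrt (1 - m * sin t ^ 2)))) 0 (PI / 2));
    [now apply is_derive_ellE_RInt|].
  apply is_RInt_unique.
  replace ((ellE m - ellK m) / (2 * m)) with (/ (2 * m) * (ellE m - ellK m)) by (field; lra).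
  eapply is_RInt_ext; [|exact (is_RInt_scal (V := R_NormedModule) _ _ _ (/ (2 * m)) _
      (is_RInt_minus (V := R_NormedModule) _ _ _ _ _ _ (is_RInt_ellE m) (is_RInt_ellK m Hm)))].
  intros t _; unfold scal, minus, plus, opp; simpl; unfold mult; simpl.
  pose proof (sqrt_modulus_pos m t Hm) as Hp; pose proof (sqrt_modulus_sqr m t Hm) as Hs.
  simpl in Hp, Hs; set (D := sqrt (1 - m * (sin t * (sin t * 1)))) in *.
  assert (Hs' : sin t * (sin t * 1) = (1 - D * D) / m) by (rewrite Hs; field; lra).
  rewrite Hs'; field; repeat split; lra.
Qed.

Lemma PI2_ge_0 : 0 <= PI / 2.
Proof. pose proof PI_RGT_0; lra. Qed.

(** From m < 1 the integrand is at least sqrt (1 - sin^2 t) = cos t, whose integral is 1. *)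
Lemma ellE_ge_1 m : m < 1 -> 1 <= ellE m.
Proof.
  intros Hm.
  apply (is_RInt_le cos (fun t => sqrt (1 - m * sin t ^ 2)) 0 (PI / 2) _ _ PI2_ge_0);
    [|apply is_RInt_ellE|].
  - replace 1 with (minus (sin (PI / 2)) (sin 0)).
    2:{ rewrite sin_PI2, sin_0; unfold minus, plus, opp; simpl; ring. }
    apply (is_RInt_derive (V := R_CompleteNormedModule) sin cos).
    + intros t _; apply is_derive_Reals, derivable_pt_lim_sin.
    + intros t _; apply (ex_derive_continuous cos); auto_derive; trivial.
  - intros t Ht.
    pose proof (sin2_cos2 t) as H; unfold Rsqr in H.
    pose proof (Rle_0_sqr (sin t)); unfold Rsqr in *.
    assert (0 <= cos t) by (apply cos_ge_0; pose proof PI_RGT_0; lra).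
    rewrite <- (sqrt_square (cos t)) at 1 by assumption.
    apply sqrt_le_1_alt; nra.
Qed.

Lemma ellE_ge_ellK m : 0 <= m < 1 -> (1 - m) * ellK m <= ellE m.
Proof.
  intros [Hm0 Hm].
  apply (is_RInt_le (fun t => (1 - m) * / sqrt (1 - m * sin t ^ 2))
    (fun t => sqrt (1 - m * sin t ^ 2)) 0 (PI / 2) _ _ PI2_ge_0);
    [|apply is_RInt_ellE|].
  - apply (is_RInt_scal (V := R_NormedModule)); now apply is_RInt_ellK.
  - intros t Ht; pose proof (sqrt_modulus_pos m t Hm) as Hp.
    pose proof (sqrt_modulus_sqr m t Hm) as Hs.
    apply (Rmult_le_reg_r (sqrt (1 - m * sin t ^ 2))); [exact Hp|].
    rewrite Rmult_assoc, Rinv_l, Hs by lra.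
    pose proof (sin2_cos2 t) as H; unfold Rsqr in H.
    pose proof (Rle_0_sqr (cos t)); unfold Rsqr in *; simpl; nra.
Qed.

(** The integrands do not compare where sin^2 t < 1/2 and m > 0. Adding m / 2 times the null
    integral of [is_RInt_modulus_boundary] makes their difference m^2 sin^2 t cos^2 t / (2 D^3),
    which is nonnegative. *)
Lemma ellE_le_ellK m : 0 <= m < 1 -> ellE m <= (1 - m / 2) * ellK m.
Proof.
  intros [Hm0 Hm].
  replace ((1 - m / 2) * ellK m) with ((1 - m / 2) * ellK m + m / 2 * 0) by ring.
  apply (is_RInt_le (fun t => sqrt (1 - m * sin t ^ 2)) (fun t =>
    (1 - m / 2) * / sqrt (1 - m * sin t ^ 2) + m / 2 *
      ((1 - 2 * sin t ^ 2) / sqrt (1 - m * sin t ^ 2) +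
       m * (sin t ^ 2 * (1 - sin t ^ 2) / sqrt (1 - m * sin t ^ 2) ^ 3)))
    0 (PI / 2) _ _ PI2_ge_0); [apply is_RInt_ellE| |].
  - apply (is_RInt_plus (V := R_NormedModule));
      apply (is_RInt_scal (V := R_NormedModule));
      [now apply is_RInt_ellK|now apply is_RInt_modulus_boundary].
  - intros t Ht; pose proof (sqrt_modulus_pos m t Hm) as Hp.
    pose proof (sqrt_modulus_sqr m t Hm) as Hs.
    pose proof (sin2_cos2 t) as H; unfold Rsqr in H.
    simpl in Hp, Hs; simpl; set (D := sqrt (1 - m * (sin t * (sin t * 1)))) in *.
    apply Rminus_le_0.
    match goal with |- 0 <= ?e => replace e with
      (m / 2 * m * (sin t * sin t * (cos t * cos t) * / (D * (D * D)))
       + (1 - m * (sin t * (sin t * 1)) - D * D) * / D) end.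
    2:{ replace (cos t * cos t) with (1 - sin t * sin t) by lra. field; lra. }
    replace (1 - m * (sin t * (sin t * 1)) - D * D) with 0 by lra.
    rewrite Rmult_0_l, Rplus_0_r.
    assert (0 < / (D * (D * D))) by (apply Rinv_0_lt_compat; repeat apply Rmult_lt_0_compat; lra).
    pose proof (Rle_0_sqr (sin t)); pose proof (Rle_0_sqr (cos t)); unfold Rsqr in *.
    apply Rmult_le_pos; [nra|]; apply Rmult_le_pos; [|lra]; now apply Rmult_le_pos.
Qed.

Lemma ellK_ge_1 m : 0 <= m < 1 -> 1 <= ellK m.
Proof.
  intros Hm; pose proof (ellE_ge_1 m (proj2 Hm)); pose proof (ellE_le_ellK m Hm); nra.
Qed.

Lemma ellK_0 : ellK 0 = PI / 2.
Proof.
  unfold ellK; rewrite (RInt_ext _ (fun _ => 1)).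
  - rewrite RInt_const; unfold scal; simpl; unfold mult; simpl; lra.
  - intros t _; rewrite Rmult_0_l, Rminus_0_r, sqrt_1; apply Rinv_1.
Qed.

Lemma ellE_0 : ellE 0 = PI / 2.
Proof.
  unfold ellE; rewrite (RInt_ext _ (fun _ => 1)).
  - rewrite RInt_const; unfold scal; simpl; unfold mult; simpl; lra.
  - intros t _; now rewrite Rmult_0_l, Rminus_0_r, sqrt_1.
Qed.

Lemma is_derive_ellK_minus_ellE m : 0 < m < 1 ->
  is_derive (fun m => ellK m - ellE m) m (ellE m / (2 * (1 - m))).
Proof.
  intros Hm.
  replace (ellE m / (2 * (1 - m))) with
    (minus ((ellE m - (1 - m) * ellK m) / (2 * m * (1 - m))) ((ellE m - ellK m) / (2 * m))).
  - apply (is_derive_minus (V := R_NormedModule));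
      [now apply is_derive_ellK|now apply is_derive_ellE].
  - unfold minus, plus, opp; simpl; field; lra.
Qed.

(* (K - E)' = E / (2 (1 - m)) >= 1 / (2 (1 - m)), whence divergence as m -> 1. *)
Lemma ellK_minus_ellE_ge m : 0 <= m < 1 -> - ln (1 - m) / 2 <= ellK m - ellE m.
Proof.
  intros [Hm0 Hm].
  destruct (Req_dec m 0) as [->|Hne].
  { rewrite ellK_0, ellE_0, Rminus_0_r, ln_1; lra. }
  set (h := fun x => ellK x - ellE x + ln (1 - x) / 2).
  assert (Hh : forall x, 0 < x < 1 ->
    is_derive h x (ellE x / (2 * (1 - x)) - / (2 * (1 - x)))).
  { intros x Hx; unfold h.
    apply (is_derive_plus (V := R_NormedModule) (fun x => ellK x - ellE x)
      (fun x => ln (1 - x) / 2)); [now apply is_derive_ellK_minus_ellE|].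
    auto_derive; [lra|field; lra]. }
  destruct (MVT_gen h 0 m (fun x => ellE x / (2 * (1 - x)) - / (2 * (1 - x)))) as [x [Hx E]].
  - rewrite Rmin_left, Rmax_right by lra; intros x Hx; apply Hh; lra.
  - rewrite Rmin_left, Rmax_right by lra; intros x Hx.
    apply continuity_pt_filterlim.
    apply (continuous_plus (V := R_NormedModule) (fun x => ellK x - ellE x)).
    + apply (continuous_minus (V := R_NormedModule) ellK ellE);
        [apply continuous_ellK|apply continuous_ellE]; lra.
    + apply (ex_derive_continuous (fun x => ln (1 - x) / 2)); auto_derive; lra.
  - rewrite Rmin_left, Rmax_right in Hx by lra.
    assert (Hx1 : 0 < / (2 * (1 - x))) by (apply Rinv_0_lt_compat; lra).
    pose proof (ellE_ge_1 x ltac:(lra)).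
    unfold h in E; rewrite ellK_0, ellE_0, (Rminus_0_r 1), ln_1 in E.
    assert (Hge : 0 <= (ellE x / (2 * (1 - x)) - / (2 * (1 - x))) * (m - 0)).
    { apply Rmult_le_pos; [unfold Rdiv; nra|lra]. }
    lra.
Qed.

(** The derivatives of K and E are rational in m, K and E, so both functions gain regularity in a
    single joint induction. *)
Lemma Ck_ell_fst k :
  Ck k (fun m _ => 0 < m < 1) (fun m _ => ellK m) /\
  Ck k (fun m _ => 0 < m < 1) (fun m _ => ellE m).
Proof.
  induction k as [|k [IHK IHE]].
  - split; intros m y Hm.
    + apply (continuity_1d_2d_pt_comp ellK (fun u _ => u)); [|apply continuity_2d_pt_id1].
      apply continuity_pt_filterlim, (continuous_ellK m); lra.
    + apply (continuity_1d_2d_pt_comp ellE (fun u _ => u)); [|apply continuity_2d_pt_id1].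
      apply continuity_pt_filterlim, (continuous_ellE m); lra.
  - assert (H1m : Ck k (fun m _ => 0 < m < 1) (fun m _ => 1 - m)).
    { apply Ck_minus; [apply Ck_const|apply Ck_fst]. }
    assert (H2m : Ck k (fun m _ => 0 < m < 1) (fun m _ => 2 * m)).
    { apply Ck_mult; [apply Ck_const|apply Ck_fst]. }
    split.
    + exists (fun m _ => (ellE m - (1 - m) * ellK m) / (2 * m * (1 - m))), (fun _ _ => 0).
      split; [|split; [|apply Ck_const]].
      * intros m y Hm; apply differentiable_pt_lim_proj1_0, is_derive_Reals.
        now apply is_derive_ellK.
      * apply (Ck_div k _ (fun m _ => ellE m - (1 - m) * ellK m)
          (fun m _ => 2 * m * (1 - m))).
        -- apply Ck_minus; [exact IHE|now apply Ck_mult].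
        -- now apply Ck_mult.
        -- intros m _ Hm; nra.
    + exists (fun m _ => (ellE m - ellK m) / (2 * m)), (fun _ _ => 0).
      split; [|split; [|apply Ck_const]].
      * intros m y Hm; apply differentiable_pt_lim_proj1_0, is_derive_Reals.
        now apply is_derive_ellE.
      * apply (Ck_div k _ (fun m _ => ellE m - ellK m) (fun m _ => 2 * m)).
        -- now apply Ck_minus.
        -- exact H2m.
        -- intros m _ Hm; lra.
Qed.

(** * Mass and momentum in the coordinates (m, b) *)

Definition wave_params (m b : R) : Prop := 0 < m < 1 /\ 0 < b.

(** Here 3 b + 1 + m is (y1 + y2 + y3) / (y3 - y1), so y3 - y1 = 2 / (3 b + 1 + m) sets the scale.
    Agreement with the orbit integrals is the content of [Mtilde_wave] and [Ptilde_wave]. *)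
Definition massF (m b : R) : R :=
  2 * (b * ellK m + ellK m - ellE m) / sqrt (3 * b + 1 + m).
Definition momF (m b : R) : R :=
  2 * ellK m * sqrt (b * (b + m) * (b + 1)) / (3 * b + 1 + m).

(* Up to positive factors, the partial logarithmic derivatives of [massF] (A1 in b,
   A2 in m) and of [momF] (A3 in m, A4 in b), where e stands for E(m) / K(m). *)
Definition jacA1 (m b e : R) : R := 3 * b + 2 * m - 1 + 3 * e.
Definition jacA2 (m b e : R) : R :=
  (3 * b + 1 + m) * (b * (e - 1 + m) + m * e) - m * (1 - m) * (b + 1 - e).
Definition jacA3 (m b e : R) : R :=
  (3 * b + 1 + m) * (b + m) * (e - 1 + m) + (3 * b + 1 + m) * m * (1 - m)
  - 2 * m * (1 - m) * (b + m).
Definition jacA4 (m b : R) : R :=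
  3 * b ^ 3 + 3 * b ^ 2 * (1 + m) + b * (2 * (1 + m) ^ 2 - 3 * m) + m * (1 + m).

(* As a polynomial in b, every coefficient is a convex quadratic in e which is
   negative at the two ends 1 - m and 1 - m / 2 of the range of e. *)
Lemma jac_neg m b e :
  0 < m < 1 -> 0 < b -> 1 - m <= e <= 1 - m / 2 ->
  jacA1 m b e * jacA3 m b e * (b * (b + 1)) - jacA2 m b e * jacA4 m b < 0.
Proof.
  intros Hm Hb He.
  (* Rescales e from its range between 1 - m and 1 - m / 2 to z between 0 and 1. *)
  set (z := 2 * (e - (1 - m)) / m).
  assert (Ez : e = 1 - m + m * z / 2) by (unfold z; field; lra).
  assert (Hz0 : 0 <= z) by (apply Rmult_le_pos; [lra|apply Rlt_le, Rinv_0_lt_compat; lra]).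
  assert (Hz1 : z <= 1) by nra.
  assert (Hzz : z * z <= z) by nra.
  clearbody z; subst e.
  (* A quadratic in z equals the interpolation of its values at 0 and 1, minus its leading
     coefficient times z - z^2. The ci interpolate the coefficients of b^i, and q * (m ^ 2 / 4)
     collects the leading coefficients. *)
  set (c0 := m ^ 2 * ((1 - z) * (- 1 + m ^ 2) + z * (- 1 - m))).
  set (c1 := m ^ 2 * ((1 - z) * (- 6 + 3 * m + 3 * m ^ 2) + z * (- 6 - 9 / 4 * m + 3 / 4 * m ^ 2))).
  set (c2 := m ^ 2 * ((1 - z) * (- 12 + 9 * m + 3 * m ^ 2) + z * (- 45 / 4 + 3 / 4 * m + 3 / 4 * m ^ 2))).
  set (c3 := m * ((1 - z) * (- 1 - 9 * m + 10 * m ^ 2) + z * (- 7 * m + 2 * m ^ 2))).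
  set (c4 := m * ((1 - z) * (- 3 + 3 * m) + z * (- 3 / 4 * m))).
  set (q := b * (3 * m + 3 * m ^ 2) + b ^ 2 * (3 + 15 * m + 3 * m ^ 2)
    + b ^ 3 * (12 + 12 * m) + b ^ 4 * 9).
  assert (E : jacA1 m b (1 - m + m * z / 2) * jacA3 m b (1 - m + m * z / 2) * (b * (b + 1))
      - jacA2 m b (1 - m + m * z / 2) * jacA4 m b =
    c0 + c1 * b + c2 * b ^ 2 + c3 * b ^ 3 + c4 * b ^ 4
    - q * (m ^ 2 / 4) * (z - z * z)).
  { unfold c0, c1, c2, c3, c4, q, jacA1, jacA2, jacA3, jacA4; field. }
  rewrite E; clear E.
  assert (Hb2 : 0 < b ^ 2) by (apply pow_lt; lra).
  assert (Hb3 : 0 < b ^ 3) by (apply pow_lt; lra).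
  assert (Hb4 : 0 < b ^ 4) by (apply pow_lt; lra).
  assert (Hm2 : 0 < m ^ 2) by (apply pow_lt; lra).
  assert (Hm2' : m ^ 2 < m) by nra.
  assert (Hconv : forall k u v, 0 < k -> u < 0 -> v < 0 -> k * ((1 - z) * u + z * v) < 0).
  { intros k u v Hk Hu Hv.
    assert ((1 - z) * u + z * v < 0) by (destruct (Rle_lt_dec z (1 / 2)); nra).
    nra. }
  assert (H0 : c0 < 0) by (apply Hconv; lra).
  assert (H1 : c1 < 0) by (apply Hconv; lra).
  assert (H2 : c2 < 0) by (apply Hconv; lra).
  assert (H3 : c3 < 0) by (apply Hconv; lra).
  assert (H4 : c4 < 0) by (apply Hconv; lra).
  assert (Hq : 0 < q).
  { unfold q; repeat apply Rplus_lt_0_compat; apply Rmult_lt_0_compat; lra. }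
  assert (Hqz : 0 <= q * (m ^ 2 / 4) * (z - z * z)).
  { apply Rmult_le_pos; [apply Rmult_le_pos; lra|lra]. }
  assert (c1 * b < 0) by nra.
  assert (c2 * b ^ 2 < 0) by nra.
  assert (c3 * b ^ 3 < 0) by nra.
  assert (c4 * b ^ 4 < 0) by nra.
  lra.
Qed.

Lemma ell_ratio_bounds m : 0 <= m < 1 -> 1 - m <= ellE m / ellK m <= 1 - m / 2.
Proof.
  intros Hm; pose proof (ellK_ge_1 m Hm).
  pose proof (ellE_ge_ellK m Hm); pose proof (ellE_le_ellK m Hm).
  split; apply (Rmult_le_reg_r (ellK m)); try lra;
    unfold Rdiv at 1; rewrite ?Rmult_assoc, ?Rinv_l by lra; unfold Rdiv in *; nra.
Qed.

Lemma ellE_le_ellK_weak m : 0 <= m < 1 -> ellE m <= ellK m.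
Proof.
  intros Hm; pose proof (ellE_le_ellK m Hm); pose proof (ellK_ge_1 m Hm); nra.
Qed.

Lemma jacA1_pos m b e : 0 <= m < 1 -> 0 <= b -> 1 - m <= e -> 0 < jacA1 m b e.
Proof. intros; unfold jacA1; lra. Qed.

Lemma differentiable_ellK m b : 0 < m < 1 ->
  differentiable_pt_lim (fun m _ => ellK m) m b
    ((ellE m - (1 - m) * ellK m) / (2 * m * (1 - m))) 0.
Proof.
  intros Hm; apply differentiable_pt_lim_proj1_0, is_derive_Reals; now apply is_derive_ellK.
Qed.

Lemma differentiable_ellE m b : 0 < m < 1 ->
  differentiable_pt_lim (fun m _ => ellE m) m b ((ellE m - ellK m) / (2 * m)) 0.
Proof.
  intros Hm; apply differentiable_pt_lim_proj1_0, is_derive_Reals; now apply is_derive_ellE.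
Qed.

Lemma differentiable_scale m b :
  differentiable_pt_lim (fun m b => 3 * b + 1 + m) m b 1 3.
Proof.
  eapply differentiable_pt_lim_eq.
  - apply differentiable_pt_lim_plus; [apply differentiable_pt_lim_plus|].
    + apply (differentiable_pt_lim_mult (fun _ _ => 3) (fun _ b => b));
        [apply differentiable_pt_lim_const|apply differentiable_pt_lim_snd].
    + apply differentiable_pt_lim_const.
    + apply differentiable_pt_lim_fst.
  - simpl; ring.
  - simpl; ring.
Qed.

Lemma differentiable_massF m b : wave_params m b ->
  differentiable_pt_lim massF m b
    (ellK m * jacA2 m b (ellE m / ellK m) /
       ((3 * b + 1 + m) * sqrt (3 * b + 1 + m) * (m * (1 - m))))
    (ellK m * jacA1 m b (ellE m / ellK m) / ((3 * b + 1 + m) * sqrt (3 * b + 1 + m))).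
Proof.
  intros [Hm Hb]; pose proof (ellK_ge_1 m ltac:(lra)) as HK.
  assert (Hs : 0 < 3 * b + 1 + m) by lra.
  pose proof (sqrt_lt_R0 _ Hs) as Hq.
  pose proof (sqrt_sqrt _ (Rlt_le _ _ Hs)) as Hqq.
  pose proof (differentiable_ellK m b Hm) as DK.
  pose proof (differentiable_ellE m b Hm) as DE.
  eapply differentiable_pt_lim_eq.
  - apply (differentiable_pt_lim_mult
      (fun m b => 2 * (b * ellK m + ellK m - ellE m))
      (fun m b => / sqrt (3 * b + 1 + m))).
    + apply (differentiable_pt_lim_mult (fun _ _ => 2)); [apply differentiable_pt_lim_const|].
      apply (differentiable_pt_lim_plus _ (fun m _ => - ellE m)).
      * apply (differentiable_pt_lim_plus (fun m b => b * ellK m)); [|exact DK].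
        apply (differentiable_pt_lim_mult (fun _ b => b));
          [apply differentiable_pt_lim_snd|exact DK].
      * apply (differentiable_pt_lim_comp_1d Ropp (fun m _ => ellE m)); [|exact DE].
        apply derivable_pt_lim_opp, derivable_pt_lim_id.
    + apply (differentiable_pt_lim_inv (fun m b => sqrt (3 * b + 1 + m))); [lra|].
      apply (differentiable_pt_lim_sqrt (fun m b => 3 * b + 1 + m)); [exact Hs|].
      apply differentiable_scale.
  - unfold jacA2; cbv beta.
    set (s := sqrt (3 * b + 1 + m)) in *.
    replace (3 * b + 1 + m) with (s * s) by exact Hqq.
    (* Expressing b through the square root s makes the identity rational in s, m, K and E. *)
    assert (Eb : b = (s * s - 1 - m) / 3) by lra.
    rewrite Eb; field; repeat split; lra.
  - unfold jacA1; cbv beta.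
    set (s := sqrt (3 * b + 1 + m)) in *.
    replace (3 * b + 1 + m) with (s * s) by exact Hqq.
    assert (Eb : b = (s * s - 1 - m) / 3) by lra.
    rewrite Eb; field; repeat split; lra.
Qed.

Lemma root_product_pos m b : 0 <= m -> 0 < b -> 0 < b * (b + m) * (b + 1).
Proof. intros; repeat apply Rmult_lt_0_compat; lra. Qed.

Lemma momF_pos m b : 0 <= m < 1 -> 0 < b -> 0 < momF m b.
Proof.
  intros Hm Hb; pose proof (ellK_ge_1 m Hm).
  pose proof (sqrt_lt_R0 _ (root_product_pos m b (proj1 Hm) Hb)).
  unfold momF; apply Rdiv_lt_0_compat; [|lra].
  repeat apply Rmult_lt_0_compat; lra.
Qed.

Lemma differentiable_root_product m b :
  differentiable_pt_lim (fun m b => b * (b + m) * (b + 1)) m b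
    (b * (b + 1)) ((b + m) * (b + 1) + b * (b + 1) + b * (b + m)).
Proof.
  eapply differentiable_pt_lim_eq.
  - apply (differentiable_pt_lim_mult (fun m b => b * (b + m)) (fun _ b => b + 1)).
    + apply (differentiable_pt_lim_mult (fun _ b => b) (fun m b => b + m)).
      * apply differentiable_pt_lim_snd.
      * apply differentiable_pt_lim_plus;
          [apply differentiable_pt_lim_snd|apply differentiable_pt_lim_fst].
    + apply differentiable_pt_lim_plus;
        [apply differentiable_pt_lim_snd|apply differentiable_pt_lim_const].
  - simpl; ring.
  - simpl; ring.
Qed.

Lemma differentiable_momF m b : wave_params m b ->
  differentiable_pt_lim momF m b
    (momF m b * jacA3 m b (ellE m / ellK m) /
       (2 * (3 * b + 1 + m) * (m * (1 - m)) * (b + m)))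
    (momF m b * jacA4 m b / (2 * (3 * b + 1 + m) * (b * (b + m) * (b + 1)))).
Proof.
  intros [Hm Hb]; pose proof (ellK_ge_1 m ltac:(lra)) as HK.
  assert (Hs : 0 < 3 * b + 1 + m) by lra.
  pose proof (root_product_pos m b ltac:(lra) Hb) as HB.
  pose proof (sqrt_lt_R0 _ HB) as Hq.
  pose proof (sqrt_sqrt _ (Rlt_le _ _ HB)) as Hqq.
  eapply differentiable_pt_lim_eq.
  - apply (differentiable_pt_lim_mult
      (fun m b => 2 * ellK m * sqrt (b * (b + m) * (b + 1)))
      (fun m b => / (3 * b + 1 + m))).
    + apply (differentiable_pt_lim_mult (fun m _ => 2 * ellK m)
        (fun m b => sqrt (b * (b + m) * (b + 1)))).
      * apply (differentiable_pt_lim_mult (fun _ _ => 2) (fun m _ => ellK m));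
          [apply differentiable_pt_lim_const|now apply differentiable_ellK].
      * apply (differentiable_pt_lim_sqrt (fun m b => b * (b + m) * (b + 1))); [exact HB|].
        apply differentiable_root_product.
    + apply (differentiable_pt_lim_inv (fun m b => 3 * b + 1 + m)); [lra|].
      apply differentiable_scale.
  - unfold jacA3, momF; cbv beta.
    set (s := sqrt (b * (b + m) * (b + 1))) in *.
    (* Moving s to the numerator leaves s^2 below, where it can be replaced by the radicand; s then
       occurs only linearly. *)
    replace (/ (2 * s)) with (s * / (2 * (s * s))) by (field; lra).
    rewrite Hqq; field; repeat split; lra.
  - unfold jacA4, momF; cbv beta.
    set (s := sqrt (b * (b + m) * (b + 1))) in *.
    replace (/ (2 * s)) with (s * / (2 * (s * s))) by (field; lra).
    rewrite Hqq; field; repeat split; lra.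
Qed.

(* The determinant is a positive multiple of the quantity in [jac_neg]. *)
Lemma mass_mom_jacobian m b Mm Mb Pm Pb : wave_params m b ->
  differentiable_pt_lim massF m b Mm Mb -> differentiable_pt_lim momF m b Pm Pb ->
  0 < Mb /\ Pm * Mb - Pb * Mm < 0.
Proof.
  intros HA HM HP; pose proof HA as [Hm Hb].
  destruct (differentiable_pt_lim_uniq _ _ _ _ _ _ _ HM (differentiable_massF m b HA)) as [-> ->].
  destruct (differentiable_pt_lim_uniq _ _ _ _ _ _ _ HP (differentiable_momF m b HA)) as [-> ->].
  pose proof (ell_ratio_bounds m ltac:(lra)) as He.
  pose proof (ellK_ge_1 m ltac:(lra)) as HK.
  set (e := ellE m / ellK m) in *.
  pose proof (jac_neg m b e Hm Hb He) as HW.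
  pose proof (jacA1_pos m b e ltac:(lra) ltac:(lra) (proj1 He)) as HA1.
  pose proof (momF_pos m b ltac:(lra) Hb) as HPp.
  pose proof (root_product_pos m b ltac:(lra) Hb) as HB.
  assert (Hs : 0 < 3 * b + 1 + m) by lra.
  pose proof (sqrt_lt_R0 _ Hs) as Hq.
  split.
  - apply Rdiv_lt_0_compat; apply Rmult_lt_0_compat; lra.
  - match goal with |- ?l < 0 => replace l with
      (ellK m * momF m b / (2 * (3 * b + 1 + m) * (3 * b + 1 + m) * sqrt (3 * b + 1 + m)
         * (m * (1 - m)) * (b * (b + m) * (b + 1))) *
       (jacA1 m b e * jacA3 m b e * (b * (b + 1)) - jacA2 m b e * jacA4 m b)) end.
    + match goal with |- ?k * _ < 0 => assert (0 < k) end.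
      { apply Rdiv_lt_0_compat; [apply Rmult_lt_0_compat; lra|].
        repeat apply Rmult_lt_0_compat; lra. }
      nra.
    + field; repeat split; lra.
Qed.

(** * Level curves of the mass *)

Lemma massF_eq_quadratic m b M : 0 <= m < 1 -> 0 <= b -> 0 < M ->
  massF m b = M <->
  ellK m ^ 2 * b ^ 2 + (2 * ellK m * (ellK m - ellE m) - 3 * M ^ 2 / 4) * b
    + ((ellK m - ellE m) ^ 2 - M ^ 2 * (1 + m) / 4) = 0.
Proof.
  intros Hm Hb HM.
  pose proof (ellE_le_ellK_weak m Hm) as HKE; pose proof (ellK_ge_1 m Hm) as HK.
  assert (Hs : 0 < 3 * b + 1 + m) by lra.
  pose proof (sqrt_lt_R0 _ Hs) as Hq.
  pose proof (sqrt_sqrt _ (Rlt_le _ _ Hs)) as Hqq.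
  assert (HN : 0 <= b * ellK m + ellK m - ellE m) by nra.
  unfold massF; set (N := b * ellK m + ellK m - ellE m) in *.
  set (s := sqrt (3 * b + 1 + m)) in *.
  (* The quadratic is 2 N / s = M squared. No solution is added, because N >= 0 and M * s > 0
     exclude 2 N = - M s. *)
  assert (EQ : ellK m ^ 2 * b ^ 2 + (2 * ellK m * (ellK m - ellE m) - 3 * M ^ 2 / 4) * b
    + ((ellK m - ellE m) ^ 2 - M ^ 2 * (1 + m) / 4) = N * N - M * M * (s * s) / 4).
  { rewrite Hqq; unfold N; field. }
  rewrite EQ; split; intros H.
  - rewrite <- H; field; lra.
  - assert (H2 : (2 * N - M * s) * (2 * N + M * s) = 0) by lra.
    apply Rmult_integral in H2; destruct H2 as [H2|H2].
    + apply (Rmult_eq_reg_r s); [|lra]; unfold Rdiv; rewrite Rmult_assoc, Rinv_l by lra; lra.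
    + assert (0 < M * s) by (apply Rmult_lt_0_compat; lra); lra.
Qed.

(** Middle and constant coefficients of the quadratic. For M > 0, [levC] is negative exactly when
    the mass at b = 0, namely 2 (K - E) / sqrt (1 + m), is below M, that is, when the level curve
    passes over m at some b > 0. *)
Definition levB (M m : R) : R := 2 * ellK m * (ellK m - ellE m) - 3 * M ^ 2 / 4.
Definition levC (M m : R) : R := (ellK m - ellE m) ^ 2 - M ^ 2 * (1 + m) / 4.

(* The larger root of the quadratic in [massF_eq_quadratic]: the level curve
   massF = M is the graph b = levb M m. *)
Definition levb (M m : R) : R :=
  (- levB M m + sqrt (levB M m ^ 2 - 4 * ellK m ^ 2 * levC M m)) / (2 * ellK m ^ 2).

(** A nonnegative root is the larger one because the slope 2 K^2 b + [levB] of the quadratic is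
    nonnegative there; this is where growth of the mass in b enters. *)
Lemma levb_unique m b M : 0 <= m < 1 -> 0 <= b -> 0 < M -> massF m b = M -> levb M m = b.
Proof.
  intros Hm Hb HM H.
  pose proof (proj1 (massF_eq_quadratic m b M Hm Hb HM) H) as Hq.
  fold (levB M m) (levC M m) in Hq.
  pose proof (ellE_le_ellK_weak m Hm) as HKE; pose proof (ellK_ge_1 m Hm) as HK.
  pose proof (ellE_ge_ellK m Hm) as HEK.
  assert (HB : 0 <= 2 * ellK m ^ 2 * b + levB M m).
  { assert (Hs : 0 < 3 * b + 1 + m) by lra.
    assert (HN : 0 <= b * ellK m + ellK m - ellE m) by nra.
    assert (EN : 4 * (b * ellK m + ellK m - ellE m) ^ 2 = M ^ 2 * (3 * b + 1 + m)).
    { unfold levB, levC in Hq; lra. }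
    set (N := b * ellK m + ellK m - ellE m) in *.
    (* Substituting 4 N^2 for M^2 (3 b + 1 + m) factors the slope. The second factor is K times
       [jacA1] at e = E / K, nonnegative because (1 - m) K <= E. *)
    assert (E2 : (2 * ellK m ^ 2 * b + levB M m) * (3 * b + 1 + m) =
      N * (2 * ellK m * (3 * b + 1 + m) - 3 * N)).
    { transitivity (2 * ellK m * N * (3 * b + 1 + m) - 3 / 4 * (M ^ 2 * (3 * b + 1 + m))).
      - unfold levB, N; field.
      - rewrite <- EN; field. }
    assert (0 <= N * (2 * ellK m * (3 * b + 1 + m) - 3 * N)).
    { apply Rmult_le_pos; [exact HN|unfold N; nra]. }
    nra. }
  unfold levb.
  replace (levB M m ^ 2 - 4 * ellK m ^ 2 * levC M m) with
    ((2 * ellK m ^ 2 * b + levB M m) * (2 * ellK m ^ 2 * b + levB M m)).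
  - rewrite sqrt_square by exact HB; field; lra.
  - replace (levC M m) with (- (ellK m ^ 2 * b ^ 2 + levB M m * b)) by lra; ring.
Qed.

Lemma levb_disc_ge m M : 0 <= m < 1 -> levC M m <= 0 ->
  levB M m ^ 2 <= levB M m ^ 2 - 4 * ellK m ^ 2 * levC M m.
Proof. intros Hm HC; pose proof (pow2_ge_0 (ellK m)); nra. Qed.

Lemma levb_nonneg m M : 0 <= m < 1 -> levC M m <= 0 -> 0 <= levb M m.
Proof.
  intros Hm HC; pose proof (levb_disc_ge m M Hm HC) as Hd.
  pose proof (ellK_ge_1 m Hm) as HK.
  apply Rmult_le_pos; [|apply Rlt_le, Rinv_0_lt_compat; nra].
  apply sqrt_le_1_alt in Hd.
  assert (Ha : sqrt (levB M m ^ 2) = Rabs (levB M m))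
    by (rewrite <- Rsqr_pow2; apply sqrt_Rsqr_abs).
  pose proof (Rle_abs (levB M m)); lra.
Qed.

Lemma massF_levb m M : 0 <= m < 1 -> 0 < M -> levC M m <= 0 -> massF m (levb M m) = M.
Proof.
  intros Hm HM HC; pose proof (levb_disc_ge m M Hm HC) as Hd.
  pose proof (ellK_ge_1 m Hm) as HK.
  apply massF_eq_quadratic; trivial; [now apply levb_nonneg|].
  fold (levB M m) (levC M m); unfold levb.
  assert (Hd0 : 0 <= levB M m ^ 2 - 4 * ellK m ^ 2 * levC M m)
    by (pose proof (pow2_ge_0 (levB M m)); lra).
  pose proof (sqrt_sqrt _ Hd0) as Hs.
  set (S := sqrt (levB M m ^ 2 - 4 * ellK m ^ 2 * levC M m)) in *.
  assert (EC : levC M m = (levB M m ^ 2 - S * S) / (4 * ellK m ^ 2)) by (rewrite Hs; field; lra).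
  rewrite EC; field; lra.
Qed.

Lemma levb_pos m M : 0 <= m < 1 -> 0 < M -> levC M m < 0 -> 0 < levb M m.
Proof.
  intros Hm HM HC; destruct (levb_nonneg m M Hm (Rlt_le _ _ HC)) as [H|H]; [exact H|].
  pose proof (massF_levb m M Hm HM (Rlt_le _ _ HC)) as E.
  rewrite <- H in E; apply massF_eq_quadratic in E; trivial; try lra.
  unfold levC in HC; lra.
Qed.

(** An algebraic form of the growth of the mass from b = 0. After elimination of M^2 the sign rests
    on 3 (K - E) <= 2 K (1 + m), a consequence of (1 - m) K <= E. *)
Lemma levC_neg m b M : 0 <= m < 1 -> 0 < b -> 0 < M -> massF m b = M -> levC M m < 0.
Proof.
  intros Hm Hb HM E.
  pose proof (ellE_le_ellK_weak m Hm) as HKE; pose proof (ellK_ge_1 m Hm) as HK.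
  pose proof (ellE_ge_ellK m Hm) as HEK.
  apply massF_eq_quadratic in E; trivial; [|lra].
  unfold levC.
  set (k := ellK m) in *; set (D := k - ellE m) in *.
  assert (EM : M ^ 2 = 4 * (b * k + D) ^ 2 / (3 * b + 1 + m)).
  { apply (Rmult_eq_reg_r (3 * b + 1 + m)); [|lra].
    unfold Rdiv; rewrite Rmult_assoc, Rinv_l by lra; lra. }
  rewrite EM.
  replace (D ^ 2 - 4 * (b * k + D) ^ 2 / (3 * b + 1 + m) * (1 + m) / 4) with
    (- (b * (b * k ^ 2 * (1 + m) + D * (2 * k * (1 + m) - 3 * D))) / (3 * b + 1 + m))
    by (field; lra).
  assert (0 <= D) by (unfold D; lra).
  assert (0 <= 2 * k * (1 + m) - 3 * D) by (unfold D; nra).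
  assert (0 < b * (b * k ^ 2 * (1 + m) + D * (2 * k * (1 + m) - 3 * D))).
  { apply Rmult_lt_0_compat; [lra|].
    apply Rplus_lt_le_0_compat; [|now apply Rmult_le_pos].
    assert (0 < k ^ 2) by (apply pow_lt; lra).
    apply Rmult_lt_0_compat; [apply Rmult_lt_0_compat|]; lra. }
  unfold Rdiv; rewrite Ropp_mult_distr_l_reverse.
  apply Ropp_lt_gt_0_contravar, Rdiv_lt_0_compat; lra.
Qed.

(** Up to a factor 4 this is the squared mass at b = 0. Its monotonicity makes the m with [levC]
    negative an interval starting at 0. The derivative is nonnegative since (1 - x) K <= E. *)
Lemma base_mass_sqr_nondecreasing m m' : 0 <= m <= m' -> m' < 1 ->
  (ellK m - ellE m) ^ 2 / (1 + m) <= (ellK m' - ellE m') ^ 2 / (1 + m').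
Proof.
  intros [H0 H1] H2.
  destruct (Req_dec m m') as [->|Hne]; [lra|].
  set (h := fun x => (ellK x - ellE x) ^ 2 / (1 + x)).
  set (dh := fun x => (2 * (ellK x - ellE x) * (ellE x / (2 * (1 - x))) * (1 + x)
    - (ellK x - ellE x) ^ 2) / (1 + x) ^ 2).
  destruct (MVT_gen h m m' dh) as [x [Hx E]].
  - rewrite Rmin_left, Rmax_right by lra; intros x Hx.
    pose proof (is_derive_ellK_minus_ellE x ltac:(lra)) as HD.
    unfold h, dh.
    evar_last.
    + apply (is_derive_div (fun x => (ellK x - ellE x) ^ 2) (fun x => 1 + x)).
      * apply (is_derive_pow (fun x => ellK x - ellE x) 2); exact HD.
      * apply (is_derive_plus (V := R_NormedModule) (fun _ => 1) (fun x => x));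
          [apply is_derive_const|apply is_derive_id].
      * lra.
    + unfold zero, one, plus; simpl; field; lra.
  - rewrite Rmin_left, Rmax_right by lra; intros x Hx; unfold h.
    assert (Hc : continuity_pt (fun x => ellK x - ellE x) x).
    { apply continuity_pt_minus; apply continuity_pt_filterlim;
        [apply (continuous_ellK x)|apply (continuous_ellE x)]; lra. }
    apply continuity_pt_div; [| |lra].
    + apply (continuity_pt_comp (fun x => ellK x - ellE x) (fun z => z ^ 2)); [exact Hc|].
      apply derivable_continuous_pt; reg.
    + apply derivable_continuous_pt; reg.
  - rewrite Rmin_left, Rmax_right in Hx by lra.
    assert (Hdh : 0 <= dh x).
    { pose proof (ellE_le_ellK_weak x ltac:(lra)).
      pose proof (ellE_ge_ellK x ltac:(lra)); pose proof (ellE_ge_1 x ltac:(lra)).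
      apply Rmult_le_pos; [|apply Rlt_le, Rinv_0_lt_compat, pow_lt; lra].
      replace (2 * (ellK x - ellE x) * (ellE x / (2 * (1 - x))) * (1 + x)
        - (ellK x - ellE x) ^ 2) with ((ellK x - ellE x) *
          ((ellE x * (1 + x) - (1 - x) * (ellK x - ellE x)) / (1 - x))) by (field; lra).
      apply Rmult_le_pos; [lra|]; apply Rmult_le_pos; [nra|].
      apply Rlt_le, Rinv_0_lt_compat; lra. }
    unfold h in E; nra.
Qed.

Lemma levC_factor M m : 0 <= m ->
  levC M m = (1 + m) * ((ellK m - ellE m) ^ 2 / (1 + m) - M ^ 2 / 4).
Proof. intros; unfold levC; field; lra. Qed.

Lemma levC_nonpos_mono M m m' : 0 <= m <= m' -> m' < 1 -> levC M m' <= 0 -> levC M m <= 0.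
Proof.
  intros H1 H2 H; pose proof (base_mass_sqr_nondecreasing m m' H1 H2).
  rewrite levC_factor in * by lra.
  assert ((ellK m' - ellE m') ^ 2 / (1 + m') - M ^ 2 / 4 <= 0) by nra; nra.
Qed.

Lemma levC_neg_mono M m m' : 0 <= m <= m' -> m' < 1 -> levC M m' < 0 -> levC M m < 0.
Proof.
  intros H1 H2 H; pose proof (base_mass_sqr_nondecreasing m m' H1 H2).
  rewrite levC_factor in * by lra.
  assert ((ellK m' - ellE m') ^ 2 / (1 + m') - M ^ 2 / 4 < 0) by nra; nra.
Qed.

(** * Monotonicity of the momentum along level curves of the mass *)

Lemma continuity_pt_ellK m : m < 1 -> continuity_pt ellK m.
Proof. intros; now apply continuity_pt_filterlim, (continuous_ellK m). Qed.

Lemma continuity_pt_ellE m : m < 1 -> continuity_pt ellE m.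
Proof. intros; now apply continuity_pt_filterlim, (continuous_ellE m). Qed.

Lemma continuity_pt_sqr f x : continuity_pt f x -> continuity_pt (fun x => f x ^ 2) x.
Proof.
  intros Hf; apply (continuity_pt_comp f (fun z => z ^ 2)); [exact Hf|].
  apply derivable_continuous_pt; reg.
Qed.

Lemma continuity_pt_sqrt_comp f x : continuity_pt f x -> continuity_pt (fun x => sqrt (f x)) x.
Proof.
  intros Hf; apply (continuity_pt_comp f sqrt); [exact Hf|].
  apply continuity_pt_filterlim, (continuous_sqrt (f x)).
Qed.

Lemma continuity_pt_id_fun x : continuity_pt (fun x => x) x.
Proof. apply derivable_continuous_pt, derivable_pt_id. Qed.

Lemma continuity_pt_cst c x : continuity_pt (fun _ => c) x.
Proof. apply derivable_continuous_pt, derivable_pt_const. Qed.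

Lemma continuity_pt_levB M m : m < 1 -> continuity_pt (levB M) m.
Proof.
  intros Hm; pose proof (continuity_pt_ellK m Hm); pose proof (continuity_pt_ellE m Hm).
  apply (continuity_pt_minus (fun m => 2 * ellK m * (ellK m - ellE m))
    (fun _ => 3 * M ^ 2 / 4)); [|apply continuity_pt_cst].
  apply (continuity_pt_mult (fun m => 2 * ellK m) (fun m => ellK m - ellE m)).
  - apply (continuity_pt_mult (fun _ => 2) ellK); [apply continuity_pt_cst|assumption].
  - now apply (continuity_pt_minus ellK ellE).
Qed.

Lemma continuity_pt_levC M m : m < 1 -> continuity_pt (levC M) m.
Proof.
  intros Hm; pose proof (continuity_pt_ellK m Hm); pose proof (continuity_pt_ellE m Hm).
  apply (continuity_pt_minus (fun m => (ellK m - ellE m) ^ 2)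
    (fun m => M ^ 2 * (1 + m) / 4)).
  - apply (continuity_pt_sqr (fun m => ellK m - ellE m)).
    now apply (continuity_pt_minus ellK ellE).
  - apply derivable_continuous_pt; reg.
Qed.

Lemma continuity_pt_levb M m : 0 <= m < 1 -> continuity_pt (levb M) m.
Proof.
  intros Hm; pose proof (continuity_pt_ellK m (proj2 Hm)).
  pose proof (continuity_pt_levB M m (proj2 Hm)); pose proof (continuity_pt_levC M m (proj2 Hm)).
  pose proof (ellK_ge_1 m Hm).
  apply (continuity_pt_div
    (fun m => - levB M m + sqrt (levB M m ^ 2 - 4 * ellK m ^ 2 * levC M m))
    (fun m => 2 * ellK m ^ 2)); [| |nra].
  - apply (continuity_pt_plus (fun m => - levB M m)
      (fun m => sqrt (levB M m ^ 2 - 4 * ellK m ^ 2 * levC M m))).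
    + now apply (continuity_pt_opp (levB M)).
    + apply continuity_pt_sqrt_comp.
      apply (continuity_pt_minus (fun m => levB M m ^ 2)
        (fun m => 4 * ellK m ^ 2 * levC M m)).
      * now apply continuity_pt_sqr.
      * apply (continuity_pt_mult (fun m => 4 * ellK m ^ 2) (levC M)); [|assumption].
        apply (continuity_pt_mult (fun _ => 4) (fun m => ellK m ^ 2));
          [apply continuity_pt_cst|now apply continuity_pt_sqr].
  - apply (continuity_pt_mult (fun _ => 2) (fun m => ellK m ^ 2));
      [apply continuity_pt_cst|now apply continuity_pt_sqr].
Qed.

Lemma continuity_pt_level_mom M m : 0 <= m < 1 -> 0 <= levb M m ->
  continuity_pt (fun m => momF m (levb M m)) m.
Proof.
  intros Hm Hb; pose proof (continuity_pt_levb M m Hm) as Hc.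
  pose proof (continuity_pt_ellK m (proj2 Hm)) as HK.
  pose proof (continuity_pt_id_fun m) as Hi.
  apply (continuity_pt_div
    (fun m => 2 * ellK m * sqrt (levb M m * (levb M m + m) * (levb M m + 1)))
    (fun m => 3 * levb M m + 1 + m)); [| |lra].
  - apply (continuity_pt_mult (fun m => 2 * ellK m)
      (fun m => sqrt (levb M m * (levb M m + m) * (levb M m + 1)))).
    + apply (continuity_pt_mult (fun _ => 2) ellK); [apply continuity_pt_cst|assumption].
    + apply continuity_pt_sqrt_comp.
      apply (continuity_pt_mult (fun m => levb M m * (levb M m + m))
        (fun m => levb M m + 1)).
      * apply (continuity_pt_mult (levb M) (fun m => levb M m + m)); [exact Hc|].
        now apply (continuity_pt_plus (levb M) (fun m => m)).
      * apply (continuity_pt_plus (levb M) (fun _ => 1)); [exact Hc|apply continuity_pt_cst].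
  - apply (continuity_pt_plus (fun m => 3 * levb M m + 1) (fun m => m)); [|exact Hi].
    apply (continuity_pt_plus (fun m => 3 * levb M m) (fun _ => 1)); [|apply continuity_pt_cst].
    apply (continuity_pt_mult (fun _ => 3) (levb M)); [apply continuity_pt_cst|exact Hc].
Qed.

(** A negative [levC] makes the discriminant positive, so its square root is differentiable. Only
    existence is recorded; the value comes from implicit differentiation. *)
Lemma ex_derive_levb M m : 0 < m < 1 -> levC M m < 0 -> ex_derive (levb M) m.
Proof.
  intros Hm HC.
  pose proof (ellK_ge_1 m ltac:(lra)) as HK.
  assert (DK : ex_derive ellK m) by (eexists; now apply is_derive_ellK).
  assert (DE : ex_derive ellE m) by (eexists; now apply is_derive_ellE).
  assert (Hd : 0 < levB M m ^ 2 - 4 * ellK m ^ 2 * levC M m).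
  { pose proof (pow2_ge_0 (levB M m)).
    assert (0 < ellK m ^ 2) by (apply pow_lt; lra); nra. }
  unfold levb, levB, levC in *; auto_derive.
  unfold Rminus, Rdiv in *; simpl in *; repeat split; auto; try lra.
  apply Rgt_not_eq; nra.
Qed.

(* Along a level curve massF = M, implicit differentiation gives
   dP/dm = (P_m M_b - P_b M_m) / M_b. *)
Lemma level_mom_derivative_neg M m1 m : 0 < M -> 0 < m < m1 -> m1 < 1 ->
  (forall x, 0 < x < m1 -> levC M x < 0) ->
  exists l, is_derive (fun m => momF m (levb M m)) m l /\ l < 0.
Proof.
  intros HM Hm Hm1 HC.
  assert (HA : wave_params m (levb M m)).
  { split; [lra|apply levb_pos; trivial; [lra|apply HC; lra]]. }
  destruct (ex_derive_levb M m ltac:(lra) (HC m Hm)) as [db Hdb].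
  pose proof (differentiable_massF m _ HA) as DM; pose proof (differentiable_momF m _ HA) as DP.
  destruct (mass_mom_jacobian m _ _ _ _ _ HA DM DP) as [HMb HJ].
  match type of DM with differentiable_pt_lim _ _ _ ?u ?v =>
    set (Mm := u) in *; set (Mb := v) in * end.
  match type of DP with differentiable_pt_lim _ _ _ ?u ?v =>
    set (Pm := u) in *; set (Pb := v) in * end.
  pose proof (derivable_pt_lim_comp_2d massF (fun t => t) (levb M) m _ _ _ _ DM
    (derivable_pt_lim_id m) (proj1 (is_derive_Reals _ _ _) Hdb)) as DcM.
  pose proof (derivable_pt_lim_comp_2d momF (fun t => t) (levb M) m _ _ _ _ DP
    (derivable_pt_lim_id m) (proj1 (is_derive_Reals _ _ _) Hdb)) as DcP.
  assert (EM : Mm * 1 + Mb * db = 0).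
  { apply (is_derive_Reals (fun t => massF t (levb M t))) in DcM.
    symmetry; transitivity (Derive (fun _ => M) m); [symmetry; apply Derive_const|].
    rewrite <- (is_derive_unique (fun t => massF t (levb M t)) m _ DcM).
    apply Derive_ext_loc.
    assert (He : 0 < Rmin m (m1 - m)) by (apply Rmin_pos; lra).
    exists (mkposreal _ He); intros x Hx.
    unfold ball in Hx; simpl in Hx; unfold AbsRing_ball, abs, minus, plus, opp in Hx; simpl in Hx.
    pose proof (Rmin_l m (m1 - m)); pose proof (Rmin_r m (m1 - m)).
    apply Rabs_def2 in Hx.
    symmetry; apply massF_levb; [lra|exact HM|apply Rlt_le, HC; lra]. }
  exists (Pm * 1 + Pb * db); split; [now apply is_derive_Reals|].
  assert ((Pm * 1 + Pb * db) * Mb < 0).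
  { replace ((Pm * 1 + Pb * db) * Mb) with
      (Pm * Mb - Pb * Mm + Pb * (Mm * 1 + Mb * db)) by ring.
    rewrite EM; lra. }
  nra.
Qed.

Lemma negative_derivative_decreasing f a b : a < b ->
  (forall x, a <= x <= b -> continuity_pt f x) ->
  (forall x, a < x < b -> exists l, is_derive f x l /\ l < 0) -> f b < f a.
Proof.
  intros Hab Hc Hd.
  assert (pr : forall x, a < x < b -> derivable_pt f x).
  { intros x Hx; exists (Derive f x); destruct (Hd x Hx) as [l [Hl _]].
    apply is_derive_Reals, Derive_correct; now exists l. }
  destruct (MVT f (fun x => x) a b pr (fun x _ => derivable_pt_id x)) as [x [Hx E]]; auto.
  { intros x _; apply derivable_continuous_pt, derivable_pt_id. }
  destruct (Hd x Hx) as [l [Hl Hl0]].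
  rewrite (derive_pt_eq_0 f x l _ (proj1 (is_derive_Reals _ _ _) Hl)) in E.
  rewrite (derive_pt_eq_0 (fun x => x) x 1 _ (derivable_pt_lim_id x)) in E.
  nra.
Qed.

(** The end m = 0 is allowed although the derivative formulas divide by m: the mean value theorem
    asks only for continuity there. This makes the upper bound in [Dt] strict. *)
Lemma level_mom_decreasing M m m' : 0 < M -> 0 <= m < m' -> m' < 1 -> levC M m' < 0 ->
  momF m' (levb M m') < momF m (levb M m).
Proof.
  intros HM Hm Hm' HC.
  assert (HCx : forall x, 0 <= x <= m' -> levC M x < 0).
  { intros x Hx; now apply (levC_neg_mono M x m'). }
  apply (negative_derivative_decreasing (fun x => momF x (levb M x))); [lra| |].
  - intros x Hx; apply continuity_pt_level_mom; [lra|].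
    apply levb_nonneg; [lra|apply Rlt_le, HCx; lra].
  - intros x Hx; apply (level_mom_derivative_neg M m' x HM); trivial; [lra|].
    intros y Hy; apply HCx; lra.
Qed.

Lemma massF_pos m b : 0 <= m < 1 -> 0 < b -> 0 < massF m b.
Proof.
  intros Hm Hb; pose proof (ellE_le_ellK_weak m Hm); pose proof (ellK_ge_1 m Hm).
  unfold massF; apply Rdiv_lt_0_compat; [nra|apply sqrt_lt_R0; lra].
Qed.

(** At m = 0 one has K = E = PI / 2 and the quadratic reads PI^2 b^2 = M^2 (3 b + 1). The inner
    square root of the bound is then 2 PI^2 b - 3 M^2. *)
Lemma level_mom_0 M : 0 < M ->
  momF 0 (levb M 0) =
  M / PI * sqrt (3 * M ^ 2 + PI ^ 2 - sqrt (9 * M ^ 4 + 4 * M ^ 2 * PI ^ 2)).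
Proof.
  intros HM; pose proof PI_RGT_0 as Hpi.
  assert (HC : levC M 0 < 0).
  { unfold levC; rewrite ellK_0, ellE_0; nra. }
  pose proof (levb_pos 0 M ltac:(lra) HM HC) as Hb.
  pose proof (massF_levb 0 M ltac:(lra) HM (Rlt_le _ _ HC)) as E.
  set (b := levb M 0) in *.
  pose proof (proj1 (massF_eq_quadratic 0 b M ltac:(lra) (Rlt_le _ _ Hb) HM) E) as EQ.
  rewrite ellK_0, ellE_0 in EQ.
  assert (EQ' : PI ^ 2 * b ^ 2 = M ^ 2 * (3 * b + 1)) by lra.
  assert (HR : sqrt (9 * M ^ 4 + 4 * M ^ 2 * PI ^ 2) = 2 * PI ^ 2 * b - 3 * M ^ 2).
  { rewrite <- (sqrt_square (2 * PI ^ 2 * b - 3 * M ^ 2)).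
    - f_equal.
      replace ((2 * PI ^ 2 * b - 3 * M ^ 2) * (2 * PI ^ 2 * b - 3 * M ^ 2)) with
        (4 * PI ^ 2 * (PI ^ 2 * b ^ 2) - 12 * PI ^ 2 * b * M ^ 2 + 9 * M ^ 4) by ring.
      rewrite EQ'; ring.
    - apply (Rmult_le_reg_r b); [exact Hb|].
      replace ((2 * PI ^ 2 * b - 3 * M ^ 2) * b) with
        (2 * (PI ^ 2 * b ^ 2) - 3 * M ^ 2 * b) by ring.
      rewrite EQ'; pose proof (pow2_ge_0 M); nra. }
  rewrite HR.
  unfold massF in E; rewrite ellK_0, ellE_0, Rplus_0_r in E.
  unfold momF; rewrite ellK_0, !Rplus_0_r.
  assert (Hs : 0 < 3 * b + 1) by lra.
  pose proof (sqrt_lt_R0 _ Hs) as Hq.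
  pose proof (sqrt_sqrt _ (Rlt_le _ _ Hs)) as Hqq.
  assert (EM : M ^ 2 = PI ^ 2 * b ^ 2 / (3 * b + 1)) by (rewrite EQ'; field; lra).
  (* With M^2 eliminated, the outer radicand is PI^2 (b + 1) / (3 b + 1), so the bound reduces to
     [momF] at (0, b). *)
  replace (3 * M ^ 2 + PI ^ 2 - (2 * PI ^ 2 * b - 3 * M ^ 2)) with
    ((PI / sqrt (3 * b + 1)) * (PI / sqrt (3 * b + 1)) * (b + 1)).
  2:{ transitivity (PI ^ 2 * (b + 1) / (3 * b + 1)).
      - rewrite <- Hqq at 3; field; lra.
      - transitivity (6 * M ^ 2 + PI ^ 2 - 2 * PI ^ 2 * b); [rewrite EM; field; lra|ring]. }
  assert (0 < PI / sqrt (3 * b + 1)) by (apply Rdiv_lt_0_compat; lra).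
  assert (Hsq : forall x, 0 <= x -> sqrt (x * x * (b + 1)) = x * sqrt (b + 1)).
  { intros x Hx; rewrite sqrt_mult by nra; now rewrite sqrt_square. }
  rewrite !Hsq by lra.
  rewrite <- E, <- Hqq at 1.
  set (s := sqrt (3 * b + 1)) in *; field; lra.
Qed.

Lemma levC_root M : 0 < M -> exists m1, 0 < m1 < 1 /\ levC M m1 = 0.
Proof.
  intros HM.
  pose proof (exp_pos (- (2 * M))) as H0.
  assert (H1 : exp (- (2 * M)) < 1) by (rewrite <- exp_0; apply exp_increasing; lra).
  (* Chosen so that - ln (1 - m) / 2 = M: then K - E >= M, and [levC] is at least M^2 - M^2 (1 + m)
     / 4 > 0. *)
  set (m := 1 - exp (- (2 * M))).
  assert (Hm : 0 < m < 1) by (unfold m; lra).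
  assert (HC : 0 < levC M m).
  { pose proof (ellK_minus_ellE_ge m ltac:(lra)) as Hge.
    replace (1 - m) with (exp (- (2 * M))) in Hge by (unfold m; ring).
    rewrite ln_exp in Hge; unfold levC; nra. }
  assert (HC0 : levC M 0 < 0) by (unfold levC; rewrite ellK_0, ellE_0; nra).
  destruct (Ranalysis5.IVT_interv (levC M) 0 m) as [x [Hx Ex]]; try lra.
  { intros a Ha; apply continuity_pt_levC; lra. }
  exists x; split; [|exact Ex].
  split; [destruct (Req_dec x 0) as [->|]; lra|lra].
Qed.

(** * The diffeomorphism from (m, b) to mass and momentum *)

Definition mass_mom (m b : R) : R * R := (massF m b, momF m b).

Lemma mass_mom_image M P :
  Dt M P <-> exists m b, wave_params m b /\ mass_mom m b = (M, P).
Proof.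
  split.
  - intros (HM & HP & HPlt).
    rewrite <- level_mom_0 in HPlt by exact HM.
    destruct (levC_root M HM) as [m1 [Hm1 HC]].
    assert (HCx : forall x, 0 <= x <= m1 -> levC M x <= 0).
    { intros x Hx; apply (levC_nonpos_mono M x m1); lra. }
    assert (Hb1 : levb M m1 = 0).
    { apply levb_unique; trivial; try lra.
      apply massF_eq_quadratic; try lra; unfold levC in HC; lra. }
    assert (Hp1 : momF m1 (levb M m1) = 0).
    { rewrite Hb1; unfold momF; rewrite !Rmult_0_l, sqrt_0; unfold Rdiv; ring. }
    (* P minus the momentum is negative at m = 0, by the upper bound on P, and equals P > 0 at
       m1. *)
    destruct (Ranalysis5.IVT_interv (fun x => P - momF x (levb M x)) 0 m1) as [m [Hm E]];
      try lra.
    { intros x Hx; apply (continuity_pt_minus (fun _ => P)); [apply continuity_pt_cst|].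
      apply continuity_pt_level_mom; [lra|].
      apply levb_nonneg; [lra|now apply HCx]. }
    assert (Hmp : 0 < m < m1).
    { split.
      - destruct (Req_dec m 0) as [->|]; lra.
      - destruct (Req_dec m m1) as [->|]; lra. }
    exists m, (levb M m).
    (* At b = 0 the momentum vanishes, which contradicts P > 0. *)
    assert (Hb : 0 < levb M m).
    { destruct (levb_nonneg m M ltac:(lra) (HCx m Hm)) as [H|H]; [exact H|].
      rewrite <- H in E; unfold momF in E.
      rewrite !Rmult_0_l, sqrt_0 in E; unfold Rdiv in E; lra. }
    split; [split; lra|].
    unfold mass_mom; f_equal; [|lra].
    apply massF_levb; [lra|exact HM|now apply HCx].
  - intros (m & b & [Hm Hb] & E); injection E as <- <-.
    pose proof (massF_pos m b ltac:(lra) Hb) as HM.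
    split; [exact HM|]; split; [apply momF_pos; lra|].
    rewrite <- level_mom_0 by exact HM.
    rewrite <- (levb_unique m b (massF m b)) at 1 by (trivial; lra).
    apply level_mom_decreasing; trivial; try lra.
    apply (levC_neg m b); trivial; lra.
Qed.

(** Equal masses put both points on one level curve, where equal momenta force equal m by strict
    decrease; [levb_unique] then recovers b. *)
Lemma mass_mom_injective : injective_2d wave_params massF momF.
Proof.
  assert (Hlt : forall m b m' b', wave_params m b -> wave_params m' b' ->
    massF m b = massF m' b' -> momF m b = momF m' b' -> ~ m < m').
  { intros m b m' b' [Hm Hb] [Hm' Hb'] EM EP Hlt.
    pose proof (massF_pos m b ltac:(lra) Hb) as HM.
    pose proof (level_mom_decreasing (massF m b) m m' HM ltac:(lra) ltac:(lra)) as HD.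
    rewrite (levb_unique m b), (levb_unique m' b') in HD by (auto; lra).
    apply Rlt_not_eq in HD; [now apply HD|].
    apply (levC_neg m' b'); auto; lra. }
  intros m b m' b' HA HA' EM EP.
  assert (E : m = m').
  { destruct (Rtotal_order m m') as [H|[H|H]]; [|exact H|]; exfalso.
    - exact (Hlt m b m' b' HA HA' EM EP H).
    - exact (Hlt m' b' m b HA' HA (eq_sym EM) (eq_sym EP) H). }
  subst m'; split; [reflexivity|].
  destruct HA as [Hm Hb]; destruct HA' as [_ Hb'].
  pose proof (massF_pos m b ltac:(lra) Hb) as HM.
  rewrite <- (levb_unique m b (massF m b)) by (trivial; lra).
  apply levb_unique; auto; lra.
Qed.

Lemma wave_params_open : open_2d wave_params.
Proof.
  intros m b [Hm Hb].
  assert (Hd : 0 < Rmin (Rmin m (1 - m)) b) by (repeat apply Rmin_pos; lra).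
  exists (mkposreal _ Hd); simpl; intros u v Hu Hv.
  pose proof (Rmin_l (Rmin m (1 - m)) b); pose proof (Rmin_r (Rmin m (1 - m)) b).
  pose proof (Rmin_l m (1 - m)); pose proof (Rmin_r m (1 - m)).
  apply Rabs_def2 in Hu; apply Rabs_def2 in Hv.
  split; lra.
Qed.

Lemma Ck_scale k U : Ck k U (fun m b => 3 * b + 1 + m).
Proof.
  apply Ck_plus; [apply Ck_plus|apply Ck_fst]; [|apply Ck_const].
  apply (Ck_mult k U (fun _ _ => 3)); [apply Ck_const|apply Ck_snd].
Qed.

Lemma Ck_root_product k U : Ck k U (fun m b => b * (b + m) * (b + 1)).
Proof.
  apply (Ck_mult k U (fun m b => b * (b + m)) (fun _ b => b + 1)).
  - apply (Ck_mult k U (fun _ b => b) (fun m b => b + m)); [apply Ck_snd|].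
    apply Ck_plus; [apply Ck_snd|apply Ck_fst].
  - apply Ck_plus; [apply Ck_snd|apply Ck_const].
Qed.

Lemma mass_mom_smooth : smooth_map_on wave_params mass_mom.
Proof.
  assert (HK : forall k, Ck k wave_params (fun m _ => ellK m)).
  { intros k; eapply Ck_subset; [|apply Ck_ell_fst]; now intros m b [H _]. }
  assert (HE : forall k, Ck k wave_params (fun m _ => ellE m)).
  { intros k; eapply Ck_subset; [|apply Ck_ell_fst]; now intros m b [H _]. }
  split; intros k; simpl.
  - apply (Ck_div k wave_params (fun m b => 2 * (b * ellK m + ellK m - ellE m))
      (fun m b => sqrt (3 * b + 1 + m))).
    + apply (Ck_mult k _ (fun _ _ => 2)); [apply Ck_const|].
      apply (Ck_minus k _ (fun m b => b * ellK m + ellK m)); [|apply HE].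
      apply (Ck_plus k _ (fun m b => b * ellK m)); [|apply HK].
      apply (Ck_mult k _ (fun _ b => b)); [apply Ck_snd|apply HK].
    + apply Ck_sqrt; [apply Ck_scale|intros m b [Hm Hb]; lra].
    + intros m b [Hm Hb]; apply Rgt_not_eq, sqrt_lt_R0; lra.
  - apply (Ck_div k wave_params (fun m b => 2 * ellK m * sqrt (b * (b + m) * (b + 1)))
      (fun m b => 3 * b + 1 + m)).
    + apply (Ck_mult k _ (fun m _ => 2 * ellK m)).
      * apply (Ck_mult k _ (fun _ _ => 2)); [apply Ck_const|apply HK].
      * apply Ck_sqrt; [apply Ck_root_product|].
        intros m b [Hm Hb]; apply root_product_pos; lra.
    + apply Ck_scale.
    + intros m b [Hm Hb]; lra.
Qed.

Lemma mass_mom_diffeomorphism : diffeomorphism wave_params Dt mass_mom.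
Proof.
  apply regular_injective_diffeomorphism.
  - exact wave_params_open.
  - exact mass_mom_smooth.
  - intros m b HA; simpl.
    pose proof (differentiable_massF m b HA) as DM; pose proof (differentiable_momF m b HA) as DP.
    destruct (mass_mom_jacobian m b _ _ _ _ HA DM DP) as [_ HJ].
    do 4 eexists; split; [exact DM|]; split; [exact DP|lra].
  - exact mass_mom_injective.
  - exact mass_mom_image.
Qed.

(** * Turning points and the domain D1 *)

(* In the variable y = r^2 the equation E = VJ J r becomes
   y^3 - 2 y^2 + 4 E y - 2 J^2 = 0; these are Vieta's relations. *)
Definition cubic_roots (J E y1 y2 y3 : R) : Prop :=
  0 < y1 /\ y1 < y2 /\ y2 < y3 /\ y1 + y2 + y3 = 2 /\
  y1 * y2 + y1 * y3 + y2 * y3 = 4 * E /\ y1 * y2 * y3 = 2 * J ^ 2.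

Lemma cubic_roots_factor J E y1 y2 y3 y : cubic_roots J E y1 y2 y3 ->
  (y - y1) * (y - y2) * (y - y3) = y ^ 3 - 2 * y ^ 2 + 4 * E * y - 2 * J ^ 2.
Proof.
  intros (_ & _ & _ & <- & <- & <-); ring.
Qed.

Lemma cubic_roots_unique J E y1 y2 y3 z1 z2 z3 :
  cubic_roots J E y1 y2 y3 -> cubic_roots J E z1 z2 z3 ->
  y1 = z1 /\ y2 = z2 /\ y3 = z3.
Proof.
  intros Hy Hz.
  assert (Hr : forall y, (y - y1) * (y - y2) * (y - y3) = 0 ->
    y = z1 \/ y = z2 \/ y = z3).
  { intros y H; rewrite (cubic_roots_factor _ _ _ _ _ _ Hy) in H.
    rewrite <- (cubic_roots_factor _ _ _ _ _ _ Hz) in H.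
    apply Rmult_integral in H; destruct H as [H|H];
      [apply Rmult_integral in H; destruct H as [H|H]|]; lra. }
  destruct Hy as (Hy0 & Hy1 & Hy2 & _); destruct Hz as (Hz0 & Hz1 & Hz2 & _).
  destruct (Hr y1 ltac:(ring)) as [H1|[H1|H1]];
    destruct (Hr y2 ltac:(ring)) as [H2|[H2|H2]];
    destruct (Hr y3 ltac:(ring)) as [H3|[H3|H3]]; lra.
Qed.

Lemma cubic_roots_roots3 J E y1 y2 y3 : cubic_roots J E y1 y2 y3 ->
  roots3 J E (sqrt y1) (sqrt y2) (sqrt y3).
Proof.
  intros H; pose proof H as (H0 & H1 & H2 & _).
  split; [now apply sqrt_lt_R0|].
  split; [apply sqrt_lt_1_alt; lra|]; split; [apply sqrt_lt_1_alt; lra|].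
  intros r Hr.
  (* Multiplying by 4 r^2 clears the denominator of the potential and gives the cubic in y = r^2. *)
  assert (Hfac : 4 * r ^ 2 * (E - VJ J r) = (r ^ 2 - y1) * (r ^ 2 - y2) * (r ^ 2 - y3)).
  { rewrite (cubic_roots_factor _ _ _ _ _ _ H); unfold VJ; field; lra. }
  assert (Hsq : forall y, 0 < y -> r ^ 2 - y = 0 <-> r = sqrt y).
  { intros y Hy; split; intros E0.
    - rewrite <- (sqrt_pow2 r) by lra; f_equal; lra.
    - rewrite E0; simpl; rewrite Rmult_1_r, sqrt_sqrt by lra; ring. }
  assert (Hr2 : 0 < r ^ 2) by (apply pow_lt; lra).
  split.
  - intros E0; rewrite E0, Rmult_0_r in Hfac; symmetry in Hfac.
    apply Rmult_integral in Hfac; destruct Hfac as [Hf|Hf];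
      [apply Rmult_integral in Hf; destruct Hf as [Hf|Hf]|];
      apply Hsq in Hf; auto; lra.
  - intros Hor.
    assert (Hz : (r ^ 2 - y1) * (r ^ 2 - y2) * (r ^ 2 - y3) = 0).
    { destruct Hor as [Hr1|[Hr1|Hr1]]; apply Hsq in Hr1; try lra; rewrite Hr1; ring. }
    rewrite Hz in Hfac; apply Rmult_integral in Hfac; lra.
Qed.

Lemma roots3_unique J E r1 r2 r3 s1 s2 s3 :
  roots3 J E r1 r2 r3 -> roots3 J E s1 s2 s3 -> r1 = s1 /\ r2 = s2 /\ r3 = s3.
Proof.
  intros (A0 & A1 & A2 & A) (B0 & B1 & B2 & B).
  pose proof (proj1 (B r1 A0) (proj2 (A r1 A0) (or_introl eq_refl))) as H1.
  pose proof (proj1 (B r2 ltac:(lra))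
    (proj2 (A r2 ltac:(lra)) (or_intror (or_introl eq_refl)))) as H2.
  pose proof (proj1 (B r3 ltac:(lra))
    (proj2 (A r3 ltac:(lra)) (or_intror (or_intror eq_refl)))) as H3.
  destruct H1 as [H1|[H1|H1]]; destruct H2 as [H2|[H2|H2]];
    destruct H3 as [H3|[H3|H3]]; lra.
Qed.

(** [root1] is an [epsilon] choice; the uniqueness of the ordered triple of roots determines it. *)
Lemma root1_eq J E r1 r2 r3 : roots3 J E r1 r2 r3 -> root1 J E = r1.
Proof.
  intros H; unfold root1.
  destruct (epsilon_spec (inhabits 0) (fun r => exists r2 r3, roots3 J E r r2 r3))
    as (s2 & s3 & Hs); [now exists r1, r2, r3|].
  apply (roots3_unique _ _ _ _ _ _ _ _ Hs H).
Qed.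

Lemma root2_eq J E r1 r2 r3 : roots3 J E r1 r2 r3 -> root2 J E = r2.
Proof.
  intros H; unfold root2.
  destruct (epsilon_spec (inhabits 0) (fun r => exists r1 r3, roots3 J E r1 r r3))
    as (s1 & s3 & Hs); [now exists r2, r1, r3|].
  apply (roots3_unique _ _ _ _ _ _ _ _ Hs H).
Qed.

Lemma inv_sqrt_3_sqr : (1 / sqrt 3) * (1 / sqrt 3) = 1 / 3.
Proof.
  pose proof (sqrt_lt_R0 3 ltac:(lra)) as Hs; pose proof (sqrt_sqrt 3 ltac:(lra)) as H.
  replace (1 / sqrt 3 * (1 / sqrt 3)) with (1 / (sqrt 3 * sqrt 3)) by (field; lra).
  now rewrite H.
Qed.

Lemma inv_sqrt_3_pos : 0 < 1 / sqrt 3.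
Proof. apply Rdiv_lt_0_compat; [lra|apply sqrt_lt_R0; lra]. Qed.

(* The cubic with double root s is (y - s)^2 (y - 2 + 2 s); it belongs to the
   critical energy s (4 - 3 s) / 4. *)
Lemma cubic_around_critical J E Q y : J = Q * (1 - Q ^ 2) ->
  y ^ 3 - 2 * y ^ 2 + 4 * E * y - 2 * J ^ 2 =
  (y - (1 - Q ^ 2)) ^ 2 * (y - 2 * Q ^ 2) +
  4 * (E - / 4 * (1 - Q ^ 2) * (3 * Q ^ 2 + 1)) * y.
Proof. intros ->; field. Qed.

Lemma continuity_pt_cubic E c y :
  continuity_pt (fun y => y ^ 3 - 2 * y ^ 2 + 4 * E * y - c) y.
Proof. apply derivable_continuous_pt; reg. Qed.

(** The cubic has signs -, +, -, + at 0 < 1 - Q^2 < 1 - q^2 < 2. At the two middle points, by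
    [cubic_around_critical], its value is a positive multiple of E minus the corresponding critical
    energy. *)
Lemma D1_cubic_roots J E : D1 J E -> exists y1 y2 y3, cubic_roots J E y1 y2 y3.
Proof.
  intros (HJ & _ & q & Q & Hq0 & Hq & HQ & HQ1 & EJq & EJQ & HE1 & HE2).
  pose proof inv_sqrt_3_sqr as H3; pose proof inv_sqrt_3_pos as H30.
  assert (Hq2 : q ^ 2 < 1 / 3) by nra.
  assert (HQ2 : 1 / 3 < Q ^ 2) by nra.
  assert (HQ2' : Q ^ 2 < 1) by nra.
  pose proof (pow2_ge_0 q) as Hq2'.
  set (p := fun y => y ^ 3 - 2 * y ^ 2 + 4 * E * y - 2 * J ^ 2).
  assert (HJ2 : 0 < J ^ 2) by (apply pow_lt; exact HJ).
  assert (P0 : p 0 < 0) by (unfold p; lra).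
  assert (Ps : 0 < p (1 - Q ^ 2)).
  { unfold p; rewrite (cubic_around_critical J E Q) by exact EJQ; nra. }
  assert (Pt : p (1 - q ^ 2) < 0).
  { unfold p; rewrite (cubic_around_critical J E q) by exact EJq; nra. }
  assert (P2 : 0 < p 2).
  { unfold p; rewrite (cubic_around_critical J E Q) by exact EJQ; nra. }
  assert (Hc : forall y, continuity_pt p y) by (intros; apply continuity_pt_cubic).
  destruct (Ranalysis5.IVT_interv p 0 (1 - Q ^ 2)) as [y1 [Hy1 E1]]; auto; try lra.
  destruct (Ranalysis5.IVT_interv (fun y => - p y) (1 - Q ^ 2) (1 - q ^ 2))
    as [y2 [Hy2 E2]]; try lra.
  { intros y _; apply (continuity_pt_opp p), Hc. }
  destruct (Ranalysis5.IVT_interv p (1 - q ^ 2) 2) as [y3 [Hy3 E3]]; auto; try lra.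
  assert (E2' : p y2 = 0) by lra.
  assert (N1 : y1 <> 0) by (intros ->; lra).
  assert (N2 : y1 <> 1 - Q ^ 2) by (intros ->; lra).
  assert (N3 : y2 <> 1 - q ^ 2) by (intros ->; lra).
  assert (L12 : y1 < y2) by lra.
  assert (L23 : y2 < y3) by lra.
  exists y1, y2, y3; unfold p in E1, E2', E3; clear p P0 Ps Pt P2 Hc E2.
  (* Vieta's relations by divided differences: cancel y2 - y1 and y3 - y1 from differences of the
     cubic, then y3 - y2 from the difference of the quotients. *)
  assert (F12 : y1 ^ 2 + y1 * y2 + y2 ^ 2 - 2 * (y1 + y2) + 4 * E = 0).
  { apply (Rmult_eq_reg_l (y2 - y1)); [|lra].
    transitivity ((y2 ^ 3 - 2 * y2 ^ 2 + 4 * E * y2 - 2 * J ^ 2)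
      - (y1 ^ 3 - 2 * y1 ^ 2 + 4 * E * y1 - 2 * J ^ 2)); [ring|lra]. }
  assert (F13 : y1 ^ 2 + y1 * y3 + y3 ^ 2 - 2 * (y1 + y3) + 4 * E = 0).
  { apply (Rmult_eq_reg_l (y3 - y1)); [|lra].
    transitivity ((y3 ^ 3 - 2 * y3 ^ 2 + 4 * E * y3 - 2 * J ^ 2)
      - (y1 ^ 3 - 2 * y1 ^ 2 + 4 * E * y1 - 2 * J ^ 2)); [ring|lra]. }
  assert (S : y1 + y2 + y3 = 2).
  { apply (Rmult_eq_reg_l (y3 - y2)); [|lra].
    transitivity ((y1 ^ 2 + y1 * y3 + y3 ^ 2 - 2 * (y1 + y3) + 4 * E)
      - (y1 ^ 2 + y1 * y2 + y2 ^ 2 - 2 * (y1 + y2) + 4 * E) + (y3 - y2) * 2); [ring|lra]. }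
  assert (E3' : y3 = 2 - y1 - y2) by lra.
  split; [lra|]; split; [lra|]; split; [lra|]; split; [exact S|].
  assert (S2 : y1 * y2 + y1 * y3 + y2 * y3 = 4 * E) by (subst y3; lra).
  split; [exact S2|].
  rewrite <- S2, E3' in E1; rewrite E3'; lra.
Qed.

Lemma continuity_pt_flux J x : continuity_pt (fun x => x * (1 - x ^ 2) - J) x.
Proof. apply derivable_continuous_pt; reg. Qed.

Lemma flux_at_inv_sqrt_3 : (1 / sqrt 3) * (1 - (1 / sqrt 3) ^ 2) = sqrt (4 / 27).
Proof.
  pose proof inv_sqrt_3_sqr as H3; pose proof inv_sqrt_3_pos as H30.
  set (x := 1 / sqrt 3) in *.
  replace (x ^ 2) with (x * x) by ring; rewrite H3.
  symmetry; rewrite <- (sqrt_square (x * (1 - 1 / 3))) by lra; f_equal.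
  replace (x * (1 - 1 / 3) * (x * (1 - 1 / 3))) with (x * x * (4 / 9)) by field.
  rewrite H3; field.
Qed.

(** The flux bound is the strict inequality of arithmetic and geometric means for the roots, whose
    sum is 2. Since y1 < 2/3 < 2 Q^2 and y3 > 2/3 > 2 q^2, evaluating [cubic_around_critical] at y1
    and at y3 gives the two energy bounds. *)
Lemma cubic_roots_D1 J E y1 y2 y3 : 0 < J -> cubic_roots J E y1 y2 y3 -> D1 J E.
Proof.
  intros HJ Hy; pose proof Hy as (H0 & H1 & H2 & S1 & S2 & S3).
  pose proof inv_sqrt_3_sqr as H3; pose proof inv_sqrt_3_pos as H30.
  assert (HJlt : J < sqrt (4 / 27)).
  { rewrite <- (sqrt_pow2 J) by lra; apply sqrt_lt_1_alt; split; [apply pow2_ge_0|].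
    assert (Hamgm : 0 < 8 - 27 * (y1 * y2 * y3)).
    { replace 8 with ((y1 + y2 + y3) ^ 3) by (rewrite S1; ring).
      replace ((y1 + y2 + y3) ^ 3 - 27 * (y1 * y2 * y3)) with
        (/ 2 * (y1 + y2 + y3) * ((y1 - y2) ^ 2 + (y2 - y3) ^ 2 + (y1 - y3) ^ 2)
         + 3 * (y1 * (y2 - y3) ^ 2 + y2 * (y1 - y3) ^ 2 + y3 * (y1 - y2) ^ 2)) by field.
      assert (0 < (y1 - y2) ^ 2) by nra.
      pose proof (pow2_ge_0 (y2 - y3)); pose proof (pow2_ge_0 (y1 - y3)).
      rewrite S1; nra. }
    lra. }
  split; [exact HJ|]; split; [exact HJlt|].
  rewrite <- flux_at_inv_sqrt_3 in HJlt.
  destruct (Ranalysis5.IVT_interv (fun x => x * (1 - x ^ 2) - J) 0 (1 / sqrt 3))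
    as [q [Hq Eq]]; try lra.
  { intros; apply continuity_pt_flux. }
  destruct (Ranalysis5.IVT_interv (fun x => - (x * (1 - x ^ 2) - J)) (1 / sqrt 3) 1)
    as [Q [HQ EQ]]; try lra.
  { intros x _; apply (continuity_pt_opp (fun x => x * (1 - x ^ 2) - J)), continuity_pt_flux. }
  { nra. }
  assert (N1 : q <> 0) by (intros ->; lra).
  assert (N2 : q <> 1 / sqrt 3) by (intros ->; lra).
  assert (N3 : Q <> 1 / sqrt 3) by (intros ->; lra).
  assert (N4 : Q <> 1) by (intros ->; lra).
  assert (EJq : J = q * (1 - q ^ 2)) by lra.
  assert (EJQ : J = Q * (1 - Q ^ 2)) by lra.
  assert (Hq2 : q ^ 2 < 1 / 3) by nra.
  assert (HQ2 : 1 / 3 < Q ^ 2) by nra.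
  exists q, Q; do 4 (split; [lra|]); split; [exact EJq|]; split; [exact EJQ|].
  assert (Hroot : forall y, y = y1 \/ y = y2 \/ y = y3 ->
    y ^ 3 - 2 * y ^ 2 + 4 * E * y - 2 * J ^ 2 = 0).
  { intros y H; rewrite <- (cubic_roots_factor _ _ _ _ _ _ Hy).
    destruct H as [-> | [-> | ->]]; ring. }
  split.
  - set (E0 := / 4 * (1 - Q ^ 2) * (3 * Q ^ 2 + 1)).
    assert (C : forall y, y = y1 \/ y = y2 \/ y = y3 ->
      (y - (1 - Q ^ 2)) ^ 2 * (y - 2 * Q ^ 2) + 4 * (E - E0) * y = 0).
    { intros y H; unfold E0; rewrite <- (cubic_around_critical J E Q y EJQ).
      now apply Hroot. }
    pose proof (C y1 ltac:(auto)) as C1; pose proof (C y2 ltac:(auto)) as C2;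
      pose proof (C y3 ltac:(auto)) as C3.
    (* If y1 is the critical point, then E is the critical energy and both y2 and y3 equal the
       remaining root 2 Q^2, contradicting y2 < y3. *)
    destruct (Req_dec y1 (1 - Q ^ 2)) as [Hs|Hs].
    + exfalso; rewrite <- Hs in *.
      assert (HE : E - E0 = 0) by nra.
      rewrite HE in C2, C3.
      assert (D2 : y2 - 2 * Q ^ 2 = 0).
      { apply (Rmult_eq_reg_l ((y2 - y1) ^ 2)); [lra|]; apply Rgt_not_eq; nra. }
      assert (D3 : y3 - 2 * Q ^ 2 = 0).
      { apply (Rmult_eq_reg_l ((y3 - y1) ^ 2)); [lra|]; apply Rgt_not_eq; nra. }
      lra.
    + assert (0 < (y1 - (1 - Q ^ 2)) ^ 2).
      { rewrite <- Rsqr_pow2; apply Rsqr_pos_lt; lra. }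
      assert (y1 - 2 * Q ^ 2 < 0) by lra.
      assert (0 < 4 * (E - E0) * y1) by nra.
      nra.
  - set (E0 := / 4 * (1 - q ^ 2) * (3 * q ^ 2 + 1)).
    assert (C : forall y, y = y1 \/ y = y2 \/ y = y3 ->
      (y - (1 - q ^ 2)) ^ 2 * (y - 2 * q ^ 2) + 4 * (E - E0) * y = 0).
    { intros y H; unfold E0; rewrite <- (cubic_around_critical J E q y EJq).
      now apply Hroot. }
    pose proof (C y1 ltac:(auto)) as C1; pose proof (C y2 ltac:(auto)) as C2;
      pose proof (C y3 ltac:(auto)) as C3.
    (* The mirror case: y1 and y2 would both equal 2 q^2. *)
    destruct (Req_dec y3 (1 - q ^ 2)) as [Hs|Hs].
    + exfalso; rewrite <- Hs in *.
      assert (HE : E - E0 = 0) by nra.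
      rewrite HE in C1, C2.
      assert (D2 : y2 - 2 * q ^ 2 = 0).
      { apply (Rmult_eq_reg_l ((y2 - y3) ^ 2)); [lra|]; apply Rgt_not_eq; nra. }
      assert (D3 : y1 - 2 * q ^ 2 = 0).
      { apply (Rmult_eq_reg_l ((y1 - y3) ^ 2)); [lra|]; apply Rgt_not_eq; nra. }
      lra.
    + assert (0 < (y3 - (1 - q ^ 2)) ^ 2).
      { rewrite <- Rsqr_pow2; apply Rsqr_pos_lt; lra. }
      assert (0 < y3 - 2 * q ^ 2) by lra.
      assert (4 * (E - E0) * y3 < 0) by nra.
      nra.
Qed.

(** * The coordinates (m, b) on D1 *)

Definition waveJ (m b : R) : R :=
  sqrt (4 * (b * (b + m) * (b + 1)) / (3 * b + 1 + m) ^ 3).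
Definition waveE (m b : R) : R :=
  (3 * b ^ 2 + 2 * b * (1 + m) + m) / (3 * b + 1 + m) ^ 2.

Definition wave_JE (m b : R) : R * R := (waveJ m b, waveE m b).

Lemma waveJ_arg_pos m b : wave_params m b ->
  0 < 4 * (b * (b + m) * (b + 1)) / (3 * b + 1 + m) ^ 3.
Proof.
  intros [Hm Hb]; pose proof (root_product_pos m b ltac:(lra) Hb).
  apply Rdiv_lt_0_compat; [lra|apply pow_lt; lra].
Qed.

Lemma waveJ_pos m b : wave_params m b -> 0 < waveJ m b.
Proof. intros H; now apply sqrt_lt_R0, waveJ_arg_pos. Qed.

(** The numbers b, b + m, b + 1 are the roots in units of y3 - y1; the factor 2 / (3 b + 1 + m)
    makes their sum 2. *)
Lemma wave_cubic_roots m b : wave_params m b ->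
  cubic_roots (waveJ m b) (waveE m b)
    (2 * b / (3 * b + 1 + m)) (2 * (b + m) / (3 * b + 1 + m)) (2 * (b + 1) / (3 * b + 1 + m)).
Proof.
  intros HA; pose proof (waveJ_arg_pos m b HA); destruct HA as [Hm Hb].
  assert (Hs : 0 < / (3 * b + 1 + m)) by (apply Rinv_0_lt_compat; lra).
  split; [apply Rdiv_lt_0_compat; lra|].
  split; [apply Rmult_lt_compat_r; lra|]; split; [apply Rmult_lt_compat_r; lra|].
  split; [field; lra|]; split; [unfold waveE; field; lra|].
  unfold waveJ; rewrite <- Rsqr_pow2, Rsqr_sqrt by lra; field; lra.
Qed.

Lemma wave_JE_injective : injective_2d wave_params waveJ waveE.
Proof.
  intros m b m' b' HA HA' EJ EE.
  pose proof (wave_cubic_roots m b HA) as H; pose proof (wave_cubic_roots m' b' HA') as H'.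
  rewrite EJ, EE in H.
  destruct (cubic_roots_unique _ _ _ _ _ _ _ _ H H') as (E1 & E2 & E3).
  destruct HA as [Hm Hb]; destruct HA' as [Hm' Hb'].
  set (s := 3 * b + 1 + m) in *; set (s' := 3 * b' + 1 + m') in *.
  assert (Hs : 0 < s) by (unfold s; lra); assert (Hs' : 0 < s') by (unfold s'; lra).
  (* The gap y3 - y1 = 2 / s recovers the scale, after which b and m are read off from y1 and y2. *)
  assert (Es : / s = / s').
  { assert (2 * (b + 1) / s - 2 * b / s = 2 * / s) by (field; lra).
    assert (2 * (b' + 1) / s' - 2 * b' / s' = 2 * / s') by (field; lra). lra. }
  unfold Rdiv in *; rewrite Es in *.
  assert (Hi : 0 < / s') by now apply Rinv_0_lt_compat.
  apply Rmult_eq_reg_r in E1; [|lra]; apply Rmult_eq_reg_r in E2; lra.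
Qed.

Lemma wave_JE_image J E : D1 J E <-> exists m b, wave_params m b /\ wave_JE m b = (J, E).
Proof.
  split.
  - intros HD; destruct (D1_cubic_roots J E HD) as (y1 & y2 & y3 & Hy).
    destruct HD as [HJ _].
    destruct Hy as (H0 & H1 & H2 & S1 & S2 & S3).
    exists ((y2 - y1) / (y3 - y1)), (y1 / (y3 - y1)).
    assert (Hs : 3 * (y1 / (y3 - y1)) + 1 + (y2 - y1) / (y3 - y1) = 2 / (y3 - y1)).
    { rewrite <- S1; field; lra. }
    split.
    + split; [split|]; try (apply Rdiv_lt_0_compat; lra).
      apply (Rmult_lt_reg_r (y3 - y1)); [lra|].
      unfold Rdiv; rewrite Rmult_assoc, Rinv_l; lra.
    + unfold wave_JE, waveJ, waveE; rewrite Hs; f_equal.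
      * rewrite <- (sqrt_pow2 J) by lra; f_equal.
        transitivity (y1 * y2 * y3 / 2); [field; lra|lra].
      * transitivity ((y1 * y2 + y1 * y3 + y2 * y3) / 4); [field; lra|lra].
  - intros (m & b & HA & HE); injection HE as <- <-.
    eapply cubic_roots_D1; [now apply waveJ_pos|now apply wave_cubic_roots].
Qed.

Lemma wave_JE_smooth : smooth_map_on wave_params wave_JE.
Proof.
  assert (Hp : forall k n, Ck k wave_params (fun m b => (3 * b + 1 + m) ^ n)).
  { intros k n; induction n as [|n IH]; simpl; [apply Ck_const|].
    apply (Ck_mult k _ (fun m b => 3 * b + 1 + m)); [apply Ck_scale|exact IH]. }
  assert (Hn : forall n m b, wave_params m b -> (3 * b + 1 + m) ^ n <> 0).
  { intros n m b [Hm Hb]; apply pow_nonzero; lra. }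
  split; intros k; simpl.
  - apply (Ck_sqrt k wave_params
      (fun m b => 4 * (b * (b + m) * (b + 1)) / (3 * b + 1 + m) ^ 3)).
    + apply (Ck_div k _ (fun m b => 4 * (b * (b + m) * (b + 1)))
        (fun m b => (3 * b + 1 + m) ^ 3)); [|apply Hp|apply Hn].
      apply (Ck_mult k _ (fun _ _ => 4)); [apply Ck_const|apply Ck_root_product].
    + apply waveJ_arg_pos.
  - apply (Ck_div k _ (fun m b => 3 * b ^ 2 + 2 * b * (1 + m) + m)
      (fun m b => (3 * b + 1 + m) ^ 2)); [|apply Hp|apply Hn].
    apply (Ck_plus k _ (fun m b => 3 * b ^ 2 + 2 * b * (1 + m)) (fun m _ => m)); [|apply Ck_fst].
    apply (Ck_plus k _ (fun _ b => 3 * b ^ 2) (fun m b => 2 * b * (1 + m))).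
    + apply (Ck_mult k _ (fun _ _ => 3)); [apply Ck_const|]; simpl.
      apply (Ck_mult k _ (fun _ b => b)); [apply Ck_snd|].
      apply (Ck_mult k _ (fun _ b => b)); [apply Ck_snd|apply Ck_const].
    + apply (Ck_mult k _ (fun _ b => 2 * b)).
      * apply (Ck_mult k _ (fun _ _ => 2)); [apply Ck_const|apply Ck_snd].
      * apply Ck_plus; [apply Ck_const|apply Ck_fst].
Qed.

Lemma differentiable_pt_lim_pow f n x y a b :
  differentiable_pt_lim f x y a b ->
  differentiable_pt_lim (fun u v => f u v ^ n) x y
    (INR n * f x y ^ pred n * a) (INR n * f x y ^ pred n * b).
Proof.
  intros Hf; apply (differentiable_pt_lim_comp_1d (fun z => z ^ n)); [|exact Hf].
  apply derivable_pt_lim_pow.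
Qed.

(** The determinant simplifies to - 2 m (1 - m) / (J s^6) with s = 3 b + 1 + m. It would vanish only
    where two roots merge, at m = 0 or m = 1. *)
Lemma wave_JE_regular : regular_2d wave_params waveJ waveE.
Proof.
  intros m b HA; pose proof (waveJ_arg_pos m b HA) as Harg.
  pose proof (waveJ_pos m b HA) as HJ; destruct HA as [Hm Hb].
  assert (Hs : 0 < 3 * b + 1 + m) by lra.
  assert (Hpow : forall n, (3 * b + 1 + m) ^ n <> 0) by (intros; apply pow_nonzero; lra).
  pose proof (differentiable_scale m b) as DS.
  assert (Dnum : differentiable_pt_lim (fun m b => 3 * b ^ 2 + 2 * b * (1 + m) + m) m b
    (2 * b + 1) (6 * b + 2 * (1 + m))).
  { eapply differentiable_pt_lim_eq.
    - apply (differentiable_pt_lim_plus (fun m b => 3 * b ^ 2 + 2 * b * (1 + m)) (fun m _ => m));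
        [|apply differentiable_pt_lim_fst].
      apply (differentiable_pt_lim_plus (fun _ b => 3 * b ^ 2) (fun m b => 2 * b * (1 + m))).
      + apply (differentiable_pt_lim_mult (fun _ _ => 3) (fun _ b => b ^ 2));
          [apply differentiable_pt_lim_const|].
        apply (differentiable_pt_lim_pow (fun _ b => b)), differentiable_pt_lim_snd.
      + apply (differentiable_pt_lim_mult (fun _ b => 2 * b) (fun m _ => 1 + m)).
        * apply (differentiable_pt_lim_mult (fun _ _ => 2) (fun _ b => b));
            [apply differentiable_pt_lim_const|apply differentiable_pt_lim_snd].
        * apply (differentiable_pt_lim_plus (fun _ _ => 1) (fun m _ => m));
            [apply differentiable_pt_lim_const|apply differentiable_pt_lim_fst].
    - simpl; ring.
    - simpl; ring. }
  pose proof (differentiable_pt_lim_mult _ _ _ _ _ _ _ _ Dnum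
    (differentiable_pt_lim_inv _ _ _ _ _ (Hpow 2%nat) (differentiable_pt_lim_pow _ 2 _ _ _ _ DS))) as DE.
  pose proof (differentiable_pt_lim_mult _ _ _ _ _ _ _ _
    (differentiable_pt_lim_mult _ _ _ _ _ _ _ _
      (differentiable_pt_lim_const 4 m b) (differentiable_root_product m b))
    (differentiable_pt_lim_inv _ _ _ _ _ (Hpow 3%nat) (differentiable_pt_lim_pow _ 3 _ _ _ _ DS))) as DG.
  pose proof (differentiable_pt_lim_sqrt
    (fun m b => 4 * (b * (b + m) * (b + 1)) / (3 * b + 1 + m) ^ 3) _ _ _ _ Harg DG) as DJ.
  do 4 eexists; split; [exact DJ|]; split; [exact DE|].
  cbv beta; change (sqrt (4 * (b * (b + m) * (b + 1)) / (3 * b + 1 + m) ^ 3)) with (waveJ m b).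
  match goal with |- ?l <> 0 => replace l with
    (- (4 * (m * (1 - m)) / (2 * waveJ m b * (3 * b + 1 + m) ^ 6))) end.
  - apply Ropp_neq_0_compat, Rgt_not_eq, Rdiv_lt_0_compat.
    + apply Rmult_lt_0_compat; [lra|apply Rmult_lt_0_compat; lra].
    + apply Rmult_lt_0_compat; [lra|apply pow_lt; lra].
  - simpl INR; simpl pred; field; split; lra.
Qed.

Lemma wave_JE_diffeomorphism : open_2d D1 /\ diffeomorphism wave_params D1 wave_JE.
Proof.
  apply regular_injective_diffeomorphism.
  - exact wave_params_open.
  - exact wave_JE_smooth.
  - exact wave_JE_regular.
  - exact wave_JE_injective.
  - exact wave_JE_image.
Qed.

(** * Reduction of the orbit integrals *)

(** Needed at the outer turning point, where [asin] is not differentiable. The function is constant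
    to the right of 1, so the continuity is two-sided. To the left, the radius 1 - cos e works
    because sin (PI / 2 - e) = cos e. *)
Lemma continuity_pt_asin_1 : continuity_pt asin 1.
Proof.
  apply continuity_pt_locally; intros eps; rewrite asin_1.
  pose proof PI_RGT_0 as Hpi; pose proof (cond_pos eps) as Heps.
  set (e := Rmin (eps / 2) (PI / 2)).
  assert (He : 0 < e) by (apply Rmin_pos; lra).
  assert (He1 : e <= eps / 2) by apply Rmin_l.
  assert (He2 : e <= PI / 2) by apply Rmin_r.
  assert (Hc0 : 0 <= cos e) by (apply cos_ge_0; lra).
  assert (Hc1 : cos e < 1) by (rewrite <- cos_0; apply cos_decreasing_1; lra).
  assert (Hd : 0 < 1 - cos e) by lra.
  exists (mkposreal _ Hd); intros x Hx.
  unfold ball in Hx; simpl in Hx; unfold AbsRing_ball, abs, minus, plus, opp in Hx; simpl in Hx.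
  apply Rabs_def2 in Hx.
  destruct (Rle_lt_dec 1 x) as [H1|H1].
  - assert (E : asin x = PI / 2).
    { unfold asin; destruct (Rle_dec x (-1)); [lra|]; destruct (Rle_dec 1 x); [reflexivity|lra]. }
    rewrite E, Rminus_eq_0, Rabs_R0; exact Heps.
  - pose proof (asin_bound x) as Hb.
    assert (Hs : sin (asin x) = x) by (apply sin_asin; lra).
    assert (Hg : PI / 2 - e < asin x).
    { apply Rnot_le_lt; intros Hle.
      apply sin_incr_1 in Hle; try lra.
      rewrite Hs, sin_shift in Hle; lra. }
    apply Rabs_def1; lra.
Qed.

Lemma is_derive_asin x : -1 < x < 1 -> is_derive asin x (1 / sqrt (1 - x ^ 2)).
Proof.
  intros Hx; apply is_derive_Reals.
  replace (x ^ 2) with (Rsqr x) by (unfold Rsqr; ring).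
  apply (derive_pt_eq_1 _ _ _ _ (derive_pt_asin x Hx)).
Qed.

Lemma cubic_roots_VJ J E y1 y2 y3 r : cubic_roots J E y1 y2 y3 -> r <> 0 ->
  2 * (E - VJ J r) = (r ^ 2 - y1) * (y2 - r ^ 2) * (y3 - r ^ 2) / (2 * r ^ 2).
Proof.
  intros H Hr.
  replace ((r ^ 2 - y1) * (y2 - r ^ 2) * (y3 - r ^ 2)) with
    ((r ^ 2 - y1) * (r ^ 2 - y2) * (r ^ 2 - y3)) by ring.
  rewrite (cubic_roots_factor _ _ _ _ _ _ H); unfold VJ; field; exact Hr.
Qed.

(** Inverse of the substitution r^2 = y1 + (y2 - y1) sin^2 t; it runs from 0 at sqrt y1 to PI / 2 at
    sqrt y2. *)
Definition angle (y1 y2 r : R) : R := asin (sqrt ((r ^ 2 - y1) / (y2 - y1))).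

Lemma between_sqrt y1 y2 r : 0 < y1 -> y1 < y2 -> sqrt y1 < r < sqrt y2 ->
  0 < r /\ y1 < r ^ 2 < y2.
Proof.
  intros H0 H1 Hr.
  pose proof (sqrt_lt_R0 y1 H0).
  pose proof (sqrt_sqrt y1 ltac:(lra)); pose proof (sqrt_sqrt y2 ltac:(lra)).
  split; [lra|split; nra].
Qed.

Lemma angle_ratio y1 y2 r : y1 < y2 -> y1 < r ^ 2 < y2 ->
  0 < (r ^ 2 - y1) / (y2 - y1) < 1.
Proof.
  intros H1 Hr; split; [apply Rdiv_lt_0_compat; lra|].
  apply (Rmult_lt_reg_r (y2 - y1)); [lra|].
  unfold Rdiv; rewrite Rmult_assoc, Rinv_l; lra.
Qed.

Lemma sqrt_unit_interval x : 0 < x < 1 -> 0 < sqrt x < 1.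
Proof.
  intros Hx; split; [apply sqrt_lt_R0; lra|].
  rewrite <- sqrt_1; apply sqrt_lt_1_alt; lra.
Qed.

Lemma sin_angle_sqr y1 y2 r : y1 < y2 -> y1 < r ^ 2 < y2 ->
  y1 + (y2 - y1) * sin (angle y1 y2 r) ^ 2 = r ^ 2.
Proof.
  intros H1 Hr; pose proof (angle_ratio y1 y2 r H1 Hr) as Hx.
  pose proof (sqrt_unit_interval _ Hx).
  unfold angle; rewrite sin_asin by lra.
  rewrite <- Rsqr_pow2, Rsqr_sqrt by lra; field; lra.
Qed.

Lemma is_derive_angle y1 y2 r : y1 < y2 -> 0 < r -> y1 < r ^ 2 < y2 ->
  is_derive (angle y1 y2) r (r / sqrt ((r ^ 2 - y1) * (y2 - r ^ 2))).
Proof.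
  intros H1 Hr0 Hr; pose proof (angle_ratio y1 y2 r H1 Hr) as Hx.
  pose proof (sqrt_unit_interval _ Hx) as Hsx.
  set (g := fun r => (r ^ 2 - y1) / (y2 - y1)).
  assert (Dg : is_derive (fun r => sqrt (g r)) r (2 * r / (y2 - y1) / (2 * sqrt (g r)))).
  { unfold g; auto_derive; [unfold Rdiv, Rminus in *; simpl in *; lra|].
    unfold Rdiv, Rminus in *; simpl in *; field; split; [lra|].
    apply Rgt_not_eq; lra. }
  evar_last.
  - apply (is_derive_comp asin (fun r => sqrt (g r))); [|exact Dg].
    apply is_derive_asin; unfold g; lra.
  - unfold scal; simpl; unfold mult; simpl; change (r * (r * 1)) with (r ^ 2).
    assert (Hd : 0 < y2 - y1) by lra.
    assert (Hy1 : 0 < r ^ 2 - y1) by lra; assert (Hy2 : 0 < y2 - r ^ 2) by lra.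
    replace (1 - sqrt (g r) * (sqrt (g r) * 1)) with ((y2 - r ^ 2) / (y2 - y1)).
    2:{ rewrite Rmult_1_r, sqrt_sqrt by (unfold g; lra); unfold g; field; lra. }
    unfold g; rewrite !sqrt_div_alt, sqrt_mult by lra.
    pose proof (sqrt_lt_R0 _ Hd); pose proof (sqrt_lt_R0 _ Hy1); pose proof (sqrt_lt_R0 _ Hy2).
    rewrite <- (sqrt_sqrt (y2 - y1)) at 1 by lra.
    set (a := sqrt (y2 - y1)) in *; set (b := sqrt (r ^ 2 - y1)) in *;
      set (c := sqrt (y2 - r ^ 2)) in *.
    field; repeat split; lra.
Qed.

Lemma continuous_angle_ratio y1 y2 r : y1 < y2 ->
  continuous (fun r => sqrt ((r ^ 2 - y1) / (y2 - y1))) r.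
Proof.
  intros H1.
  apply (continuous_comp (fun r => (r ^ 2 - y1) / (y2 - y1)) sqrt); [|apply continuous_sqrt].
  apply (ex_derive_continuous (fun r => (r ^ 2 - y1) / (y2 - y1))); auto_derive; lra.
Qed.

Lemma angle_left_end y1 y2 : 0 < y1 < y2 ->
  angle y1 y2 (sqrt y1) = 0 /\ continuous (angle y1 y2) (sqrt y1).
Proof.
  intros H.
  assert (E : sqrt ((sqrt y1 ^ 2 - y1) / (y2 - y1)) = 0).
  { rewrite <- Rsqr_pow2, Rsqr_sqrt, Rminus_eq_0 by lra.
    unfold Rdiv; rewrite Rmult_0_l; apply sqrt_0. }
  split; [unfold angle; rewrite E; apply asin_0|].
  apply (continuous_comp (fun r => sqrt ((r ^ 2 - y1) / (y2 - y1))) asin).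
  - apply continuous_angle_ratio; lra.
  - rewrite E; apply (ex_derive_continuous asin); eexists; apply is_derive_asin; lra.
Qed.

Lemma angle_right_end y1 y2 : 0 < y1 < y2 ->
  angle y1 y2 (sqrt y2) = PI / 2 /\ continuous (angle y1 y2) (sqrt y2).
Proof.
  intros H.
  assert (E : sqrt ((sqrt y2 ^ 2 - y1) / (y2 - y1)) = 1).
  { rewrite <- Rsqr_pow2, Rsqr_sqrt by lra.
    unfold Rdiv; rewrite Rinv_r by lra; apply sqrt_1. }
  split; [unfold angle; rewrite E; apply asin_1|].
  apply (continuous_comp (fun r => sqrt ((r ^ 2 - y1) / (y2 - y1))) asin).
  - apply continuous_angle_ratio; lra.
  - rewrite E; apply continuity_pt_filterlim, continuity_pt_asin_1.
Qed.

(** The integrand in the variable t. Only the factor y3 - r^2 survives under the root, and it stays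
    positive up to both ends. The weight h covers the mass (identity) and the period (constant 1) at
    once. *)
Definition angle_weight (h : R -> R) (y1 y2 y3 t : R) : R :=
  sqrt 2 * h (y1 + (y2 - y1) * sin t ^ 2) / sqrt (y3 - (y1 + (y2 - y1) * sin t ^ 2)).

Lemma continuous_angle_weight h y1 y2 y3 t : y1 < y2 < y3 -> (forall y, ex_derive h y) ->
  continuous (angle_weight h y1 y2 y3) t.
Proof.
  intros Hy Hh; unfold angle_weight.
  assert (Hp : 0 < y3 - (y1 + (y2 - y1) * sin t ^ 2)).
  { pose proof (sin2_cos2 t) as H; unfold Rsqr in H.
    pose proof (Rle_0_sqr (cos t)); unfold Rsqr in *; simpl; nra. }
  pose proof (sqrt_lt_R0 _ Hp).
  apply (ex_derive_continuous (fun t => sqrt 2 * h (y1 + (y2 - y1) * sin t ^ 2) /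
    sqrt (y3 - (y1 + (y2 - y1) * sin t ^ 2)))).
  auto_derive; unfold Rminus in *; simpl in *; repeat split; auto.
  apply Rgt_not_eq; lra.
Qed.

(* Substitution r^2 = y1 + (y2 - y1) sin^2 t, which removes both endpoint
   singularities. *)
Lemma is_RInt_gen_orbit J E y1 y2 y3 h : cubic_roots J E y1 y2 y3 ->
  (forall y, ex_derive h y) ->
  is_RInt_gen (fun r => h (r ^ 2) / sqrt (2 * (E - VJ J r)))
    (at_right (sqrt y1)) (at_left (sqrt y2))
    (RInt (angle_weight h y1 y2 y3) 0 (PI / 2)).
Proof.
  intros Hc Hh; pose proof Hc as (H0 & H1 & H2 & _).
  set (f := fun r => h (r ^ 2) / sqrt (2 * (E - VJ J r))).
  set (w := angle_weight h y1 y2 y3).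
  assert (Hw : forall t, continuous w t)
    by (intros t; apply continuous_angle_weight; [lra|exact Hh]).
  set (W := (fun x => RInt w 0 x) : R -> R).
  assert (DW : forall x, is_derive W x (w x)).
  { intros x; apply (is_derive_RInt (V := R_CompleteNormedModule) w W 0 x); [|apply Hw].
    apply filter_forall; intros z; apply (RInt_correct (V := R_CompleteNormedModule)).
    apply (ex_RInt_continuous (V := R_CompleteNormedModule)); intros; apply Hw. }
  (* H is an antiderivative of f on the open interval and is continuous at both ends, so the
     improper integral is the difference of its end values. *)
  set (H := (fun r => W (angle y1 y2 r)) : R -> R).
  assert (DH : forall r, sqrt y1 < r < sqrt y2 -> is_derive H r (f r)).
  { intros r Hr; destruct (between_sqrt y1 y2 r H0 H1 Hr) as [Hr0 Hr2].
    evar_last.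
    - apply (is_derive_comp W (angle y1 y2)); [apply DW|].
      apply is_derive_angle; lra.
    - unfold scal; simpl; unfold mult; simpl.
      unfold w, angle_weight; rewrite sin_angle_sqr by lra.
      unfold f; rewrite (cubic_roots_VJ _ _ _ _ _ _ Hc) by lra.
      change (r * (r * 1)) with (r ^ 2).
      assert (P1 : 0 < (r ^ 2 - y1) * (y2 - r ^ 2)) by (apply Rmult_lt_0_compat; lra).
      assert (P2 : 0 < y3 - r ^ 2) by lra.
      rewrite sqrt_div_alt by nra.
      rewrite (sqrt_mult ((r ^ 2 - y1) * (y2 - r ^ 2))), (sqrt_mult 2) by nra.
      rewrite (sqrt_pow2 r) by lra.
      pose proof (sqrt_lt_R0 _ P1); pose proof (sqrt_lt_R0 _ P2).
      pose proof (sqrt_lt_R0 2 ltac:(lra)).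
      field; repeat split; lra. }
  assert (Cf : forall r, sqrt y1 < r < sqrt y2 -> continuous f r).
  { intros r Hr; destruct (between_sqrt y1 y2 r H0 H1 Hr) as [Hr0 Hr2].
    assert (Hp : 0 < 2 * (E - VJ J r)).
    { rewrite (cubic_roots_VJ _ _ _ _ _ _ Hc) by lra.
      apply Rdiv_lt_0_compat; [|nra]; repeat apply Rmult_lt_0_compat; lra. }
    pose proof (sqrt_lt_R0 _ Hp).
    apply (ex_derive_continuous f); unfold f, VJ in *; auto_derive.
    unfold Rminus, Rdiv in *; simpl in *; repeat split; auto;
      apply Rgt_not_eq; nra. }
  (* The filters do not order the two integration bounds, hence the minimum and maximum: the whole
     segment between them lies in the open interval. *)
  assert (Hprod : filter_prod (at_right (sqrt y1)) (at_left (sqrt y2))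
    (fun ab => forall x, Rmin (fst ab) (snd ab) <= x <= Rmax (fst ab) (snd ab) ->
      sqrt y1 < x < sqrt y2)).
  { assert (Hlt : sqrt y1 < sqrt y2) by (apply sqrt_lt_1_alt; lra).
    apply (Filter_prod _ _ _ (fun a => sqrt y1 < a < sqrt y2) (fun b => sqrt y1 < b < sqrt y2)).
    - unfold at_right, within; apply filter_imp with (fun a => a < sqrt y2).
      + intros a Ha Ha'; lra.
      + apply (open_lt (sqrt y2) (sqrt y1) Hlt).
    - unfold at_left, within; apply filter_imp with (fun a => sqrt y1 < a).
      + intros a Ha Ha'; lra.
      + apply (open_gt (sqrt y1) (sqrt y2) Hlt).
    - intros a b Ha Hb x Hx; simpl in Hx.
      destruct (Rle_dec a b); [rewrite Rmin_left, Rmax_right in Hx by lra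
                              |rewrite Rmin_right, Rmax_left in Hx by lra]; lra. }
  assert (EDH : forall r, sqrt y1 < r < sqrt y2 -> Derive H r = f r).
  { intros r Hr; apply is_derive_unique, DH, Hr. }
  destruct (angle_left_end y1 y2 ltac:(lra)) as [A1 C1].
  destruct (angle_right_end y1 y2 ltac:(lra)) as [A2 C2].
  assert (EI : W (PI / 2) = H (sqrt y2) - H (sqrt y1)).
  { assert (W0 : W 0 = 0) by exact (RInt_point (V := R_CompleteNormedModule) 0 w).
    unfold H; rewrite A1, A2, W0; symmetry; apply Rminus_0_r. }
  change (is_RInt_gen f (at_right (sqrt y1)) (at_left (sqrt y2)) (W (PI / 2))).
  rewrite EI.
  (* [is_RInt_gen_Derive] integrates [Derive H] literally, so f is first exchanged for it. *)
  apply (is_RInt_gen_ext (Derive H)).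
  { apply filter_imp with (2 := Hprod); intros ab Hab x Hx.
    apply EDH, Hab; lra. }
  assert (CW : forall x, continuous W x).
  { intros x; apply (ex_derive_continuous W); eexists; apply DW. }
  apply (is_RInt_gen_Derive H (H (sqrt y1)) (H (sqrt y2))).
  - apply filter_imp with (2 := Hprod); intros ab Hab x Hx.
    eexists; apply DH, Hab, Hx.
  - apply filter_imp with (2 := Hprod); intros ab Hab x Hx; specialize (Hab x Hx).
    apply (continuous_ext_loc (Derive H) f x); [|now apply Cf].
    apply filter_imp with (fun r => sqrt y1 < r /\ r < sqrt y2).
    + intros r Hr; symmetry; now apply EDH.
    + apply filter_and; [apply (open_gt (sqrt y1) x)|apply (open_lt (sqrt y2) x)]; apply Hab.
  - apply (filterlim_filter_le_1 (F := locally (sqrt y1)) (G := at_right (sqrt y1)) H).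
    + apply filter_le_within.
    + apply (continuous_comp (angle y1 y2) W); [exact C1|apply CW].
  - apply (filterlim_filter_le_1 (F := locally (sqrt y2)) (G := at_left (sqrt y2)) H).
    + apply filter_le_within.
    + apply (continuous_comp (angle y1 y2) W); [exact C2|apply CW].
Qed.

Lemma RInt_gen_orbit m b h : wave_params m b -> (forall y, ex_derive h y) ->
  let s := 3 * b + 1 + m in
  RInt_gen (fun r => h (r ^ 2) / sqrt (2 * (waveE m b - VJ (waveJ m b) r)))
    (at_right (root1 (waveJ m b) (waveE m b))) (at_left (root2 (waveJ m b) (waveE m b))) =
  RInt (fun t => sqrt s * (h (2 / s * (b + m * sin t ^ 2)) * / sqrt (1 - m * sin t ^ 2)))
    0 (PI / 2).
Proof.
  intros HA Hh s; pose proof (wave_cubic_roots m b HA) as Hc.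
  pose proof (cubic_roots_roots3 _ _ _ _ _ Hc) as H3.
  rewrite (root1_eq _ _ _ _ _ H3), (root2_eq _ _ _ _ _ H3).
  rewrite (is_RInt_gen_unique _ _ (is_RInt_gen_orbit _ _ _ _ _ h Hc Hh)).
  apply RInt_ext; intros t _; unfold angle_weight; fold s.
  destruct HA as [Hm Hb]; assert (Hs : 0 < s) by (unfold s; lra).
  replace (2 * b / s + (2 * (b + m) / s - 2 * b / s) * sin t ^ 2) with
    (2 / s * (b + m * sin t ^ 2)) by (field; lra).
  (* In these coordinates y3 - r^2 is proportional to 1 - m sin^2 t, which is how the elliptic
     modulus appears. *)
  replace (2 * (b + 1) / s - 2 / s * (b + m * sin t ^ 2)) with
    (2 / s * (1 - m * sin t ^ 2)) by (field; lra).
  pose proof (modulus_pos m t ltac:(lra)) as Hd; pose proof (sqrt_modulus_pos m t ltac:(lra)) as Hd'.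
  assert (0 < 2 / s) by (apply Rdiv_lt_0_compat; lra).
  rewrite sqrt_mult, sqrt_div_alt by lra.
  pose proof (sqrt_lt_R0 2 ltac:(lra)); pose proof (sqrt_lt_R0 s Hs).
  set (D := sqrt (1 - m * sin t ^ 2)) in *.
  (* The equality is restated at type [R] so that [field] recognises it. *)
  match goal with |- @eq _ ?l ?r => change (@eq R l r) end.
  field; repeat split; lra.
Qed.

(** With D = sqrt (1 - m sin^2 t) one has b + m sin^2 t = b + 1 - D^2, so division by D splits the
    integrand into those of (b + 1) K and of E. *)
Lemma Mtilde_wave m b : wave_params m b -> Mtilde (waveJ m b) (waveE m b) = massF m b.
Proof.
  intros HA; unfold Mtilde.
  rewrite (RInt_gen_orbit m b (fun y => y) HA); [|intros y; auto_derive; trivial].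
  destruct HA as [Hm Hb].
  set (s := 3 * b + 1 + m); assert (Hs : 0 < s) by (unfold s; lra).
  pose proof (sqrt_lt_R0 s Hs) as Hq; pose proof (sqrt_sqrt s ltac:(lra)) as Hqq.
  apply is_RInt_unique.
  replace (massF m b) with (2 / sqrt s * ((b + 1) * ellK m - ellE m))
    by (unfold massF; fold s; field; lra).
  eapply is_RInt_ext; [|exact (is_RInt_scal (V := R_NormedModule) _ _ _ (2 / sqrt s) _
    (is_RInt_minus (V := R_NormedModule) _ _ _ _ _ _
      (is_RInt_scal (V := R_NormedModule) _ _ _ (b + 1) _ (is_RInt_ellK m (proj2 Hm)))
      (is_RInt_ellE m)))].
  intros t _; unfold scal, minus, plus, opp; simpl; unfold mult; simpl.
  pose proof (sqrt_modulus_pos m t ltac:(lra)) as Hd.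
  pose proof (sqrt_modulus_sqr m t ltac:(lra)) as Hdd.
  simpl in Hd, Hdd; set (D := sqrt (1 - m * (sin t * (sin t * 1)))) in *.
  replace (m * (sin t * (sin t * 1))) with (1 - D * D) by lra.
  replace (2 / s) with (2 / (sqrt s * sqrt s)) by now rewrite Hqq.
  field; split; lra.
Qed.

Lemma Ptilde_wave m b : wave_params m b -> Ptilde (waveJ m b) (waveE m b) = momF m b.
Proof.
  intros HA; unfold Ptilde, Tper.
  rewrite (RInt_gen_orbit m b (fun _ => 1) HA); [|intros y; auto_derive; trivial].
  destruct HA as [Hm Hb].
  set (s := 3 * b + 1 + m); assert (Hs : 0 < s) by (unfold s; lra).
  pose proof (sqrt_lt_R0 s Hs) as Hq; pose proof (sqrt_sqrt s ltac:(lra)) as Hqq.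
  replace (RInt _ 0 (PI / 2)) with (sqrt s * ellK m).
  2:{ symmetry; apply is_RInt_unique.
      eapply is_RInt_ext; [|exact (is_RInt_scal (V := R_NormedModule) _ _ _ (sqrt s) _
        (is_RInt_ellK m (proj2 Hm)))].
      intros t _; unfold scal; simpl; unfold mult; simpl; ring. }
  pose proof (root_product_pos m b ltac:(lra) Hb) as HB.
  unfold waveJ, momF; fold s.
  assert (EJ : sqrt (4 * (b * (b + m) * (b + 1)) / s ^ 3) =
    2 * sqrt (b * (b + m) * (b + 1)) / (s * sqrt s)).
  { replace (4 * (b * (b + m) * (b + 1)) / s ^ 3) with
      ((2 / s) * (2 / s) * ((b * (b + m) * (b + 1)) / s)) by (field; lra).
    assert (0 < 2 / s) by (apply Rdiv_lt_0_compat; lra).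
    assert (0 < b * (b + m) * (b + 1) / s) by (apply Rdiv_lt_0_compat; lra).
    rewrite sqrt_mult, sqrt_square, sqrt_div_alt by nra.
    field; split; lra. }
  rewrite EJ; field; split; lra.
Qed.

(** * Transfer from (m, b) back to (J, E) *)

Theorem theorem6 : diffeomorphism D1 Dt Psi.
Proof.
  destruct wave_JE_diffeomorphism as [HD1 Hwave].
  apply (diffeomorphism_factor wave_params D1 Dt wave_JE mass_mom Psi HD1 Hwave
    mass_mom_diffeomorphism).
  intros m b HA; unfold Psi, wave_JE, mass_mom; simpl.
  now rewrite Mtilde_wave, Ptilde_wave.
Qed.
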